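(* Let $\varphi(z)$ be a complex-valued function in the Schur-Agler class on the unit ball $\mathbb{B}_d$. Then for each $z\in\mathbb{B}_d$ and any nonnegative integers $n_1,\dots,n_d$ which are not all zero, $$\left|\frac{\partial^{n}\varphi}{\partial z_d^{n_d}\cdots\partial z_1^{n_1}}(z)\right|\le d^{(n-1)/2}\,n_1!\,n_2!\cdots n_d!\;\frac{1-|\varphi(z)|^2}{(1-\|z\|_2^2)(1-\|z\|_2)^{n-1}},$$ where $n=n_1+\cdots+n_d$.
   Context: Here $d\ge 1$ and $\mathbb{B}_d=\{(z_1,\dots,z_d)\in\mathbb{C}^d:|z_1|^2+\cdots+|z_d|^2<1\}$. For $z,w\in\mathbb{C}^d$, $\langle z,w\rangle=z_1\bar w_1+\cdots+z_d\bar w_d$ and $\|z\|_2=\langle z,z\rangle^{1/2}$. The Arveson space is the Hilbert space of analytic functions on $\mathbb{B}_d$ with reproducing kernel $k(w,z)=1/(1-\langle z,w\rangle)$. The Schur-Agler class on the unit ball is the class of contractive multipliers of the Arveson space, i.e. analytic functions $\varphi$ on $\mathbb{B}_d$ such that multiplication by $\varphi$ is an everywhere defined operator on the Arveson space of norm at most one. Equivalently, the kernel $[1-\varphi(z)\overline{\varphi(w)}]/(1-\langle z,w\rangle)$ is nonnegative on $\mathbb{B}_d$, that is, $\sum_{j,k=1}^m \frac{1-\varphi(z^{(k)})\overline{\varphi(z^{(j)})}}{1-\langle z^{(k)},z^{(j)}\rangle}c_j\bar c_k\ge 0$ for any positive integer $m$, any points $z^{(1)},\dots,z^{(m)}\in\mathbb{B}_d$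 and any complex numbers $c_1,\dots,c_m$. *)

(* Defs.v *)
From mathcomp Require Import all_boot all_order all_algebra.
From mathcomp Require Import all_classical all_reals all_analysis.
From mathcomp Require Import complex.

Set Implicit Arguments.
Unset Strict Implicit.
Unset Printing Implicit Defensive.

Import Order.TTheory GRing.Theory Num.Theory.
Import numFieldNormedType.Exports.

Local Open Scope ring_scope.
Local Open Scope classical_set_scope.

(* The definitions are parametrized by an abstract numClosedFieldType [C], to be
   instantiated with the complex numbers [R[i]], R : realType: for abstract [C]
   the topology and normed-module structures of [C] and of ['rV[C]_d] are inferred
   from the field structure, whereas on [R[i]] itself they are not canonical.
   Real numbers are the real elements of [C]; in particular [x <= y] in [C]
   implies that [y - x] is real. *)
Section SchurAgler.
Variables (C : numClosedFieldType) (d : nat).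
Implicit Types (z w a : 'rV[C]_d) (f g h phi : 'rV[C]_d -> C).

Definition cdot z w : C := \sum_(i < d) z 0 i * (w 0 i)^*.

Definition enorm z : C := sqrtC (cdot z z).

Definition unit_ball : set 'rV[C]_d := [set z | \sum_(i < d) `|z 0 i| ^+ 2 < 1].

Definition monomial z (k : 'I_d -> nat) : C := \prod_(i < d) z 0 i ^+ k i.

(* The N-th partial sum of a multiple power series runs over the box [0, N[^d;
   absolute convergence is boundedness of the partial sums of the moduli. *)
Definition analytic_at f a :=
  exists (c : ('I_d -> nat) -> C) (r : C), 0 < r /\
    forall z, enorm (z - a) < r ->
      (exists M : C, forall N : nat,
        \sum_(k : {ffun 'I_d -> 'I_N})
           `|c (fun i => k i) * monomial (z - a) (fun i => k i)| <= M) /\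
      (fun N : nat => \sum_(k : {ffun 'I_d -> 'I_N})
           c (fun i => k i) * monomial (z - a) (fun i => k i))
        @ \oo --> f z.

Definition analytic_on (D : set 'rV[C]_d) f := forall a, D a -> analytic_at f a.

(* Functions on the ball are represented by their extensions by zero. *)
Definition arveson_kernel w : 'rV[C]_d -> C :=
  fun z => if z \in unit_ball then 1 / (1 - cdot z w) else 0.

Definition linear_subspace (H : set ('rV[C]_d -> C)) :=
  H (fun=> 0) /\
  (forall (a : C) f g, H f -> H g -> H (fun z => a * f z + g z)).

(* [ip] is an inner product on [H]; its values outside [H] are irrelevant. *)
Definition inner_product (H : set ('rV[C]_d -> C))
    (ip : ('rV[C]_d -> C) -> ('rV[C]_d -> C) -> C) :=
  [/\ forall (a : C) f g h, H f -> H g -> H h ->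
        ip (fun z => a * f z + g z) h = a * ip f h + ip g h,
      forall f g, H f -> H g -> ip g f = (ip f g)^*,
      forall f, H f -> 0 <= ip f f &
      forall f, H f -> ip f f = 0 -> f = (fun=> 0)].

Definition ip_norm (ip : ('rV[C]_d -> C) -> ('rV[C]_d -> C) -> C) f : C :=
  sqrtC (ip f f).

Definition ip_complete (H : set ('rV[C]_d -> C))
    (ip : ('rV[C]_d -> C) -> ('rV[C]_d -> C) -> C) :=
  forall u : nat -> 'rV[C]_d -> C,
    (forall n, H (u n)) ->
    (forall e : C, 0 < e -> exists N : nat, forall m n : nat,
       (N <= m)%N -> (N <= n)%N -> ip_norm ip (u m \- u n) < e) ->
    exists2 f, H f & forall e : C, 0 < e -> exists N : nat, forall n : nat,
       (N <= n)%N -> ip_norm ip (u n \- f) < e.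

(* By the Moore-Aronszajn theorem these properties determine [H] and the
   restriction of [ip] to [H] uniquely, and such a pair exists. *)
Record is_arveson_space (H : set ('rV[C]_d -> C))
    (ip : ('rV[C]_d -> C) -> ('rV[C]_d -> C) -> C) : Prop := IsArvesonSpace {
  arveson_supp : forall f, H f -> forall z, ~ unit_ball z -> f z = 0;
  arveson_analytic : forall f, H f -> analytic_on unit_ball f;
  arveson_subspace : linear_subspace H;
  arveson_ip : inner_product H ip;
  arveson_complete : ip_complete H ip;
  arveson_kernel_mem : forall w, unit_ball w -> H (arveson_kernel w);
  arveson_reproducing : forall f w, H f -> unit_ball w ->
    f w = ip f (arveson_kernel w) }.

Definition contractive_multiplier (H : set ('rV[C]_d -> C))
    (ip : ('rV[C]_d -> C) -> ('rV[C]_d -> C) -> C) phi :=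
  forall f, H f ->
    H (fun z => phi z * f z) /\
    ip_norm ip (fun z => phi z * f z) <= ip_norm ip f.

(* Only the values of [phi] on the ball matter. *)
Definition schur_agler phi :=
  analytic_on unit_ball phi /\
  exists H ip, is_arveson_space H ip /\ contractive_multiplier H ip phi.

Definition partial (j : 'I_d) f : 'rV[C]_d -> C := fun z => 'D_(delta_mx 0 j) f z.

(* [enum 'I_d] is increasing, so the differentiations in the first variable are
   performed first. *)
Definition mixed_partial (n : 'I_d -> nat) f : 'rV[C]_d -> C :=
  foldl (fun g j => iter (n j) (partial j) g) f (enum 'I_d).

End SchurAgler.

(* Main.v *)
Require Import Defs.
From mathcomp Require Import all_boot all_order all_algebra.
From mathcomp Require Import all_classical all_reals all_analysis.
From mathcomp Require Import complex.
From mathcomp Require Import ring.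

Import Order.TTheory GRing.Theory Num.Theory.

Local Open Scope ring_scope.

Set Implicit Arguments.
Unset Strict Implicit.
Unset Printing Implicit Defensive.

Import numFieldNormedType.Exports.

(* The kernel [(1 - phi w * (phi w')^* ) / (1 - <w, w'>)] is nonnegative, so at any
   finite set of points [phi] agrees with a transfer function
   [e + c (1 - w.A)^-1 (w.B)] of a finite-dimensional contractive colligation
   [A; B; c; e].  With [R = (1 - z.A)^-1], its Taylor coefficient of index [al],
   [n = |al|], is a sum over the words of content [al] of terms
   [c R A_{j_1} R ... A_{j_{n-1}} R T_{j_n}], where contractivity bounds [|c R|^2]
   and [sum_j |T_j|^2] by [(1 - |phi z|^2) / (1 - |z|^2)] and [R] by
   [(1 - |z|)^-1].  Since the first [n - 1] letters of a word of given content
   determine the last one, there are at most [d^(n-1)] such words, and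
   Cauchy-Schwarz gives the factor [d^((n-1)/2)].

   The bounds on the coefficients and on the Taylor remainder do not depend on the
   finite set.  Applied to finer and finer grids around [z], they pass to the
   coefficients [a z al] of the power series of [phi] at [z], with a remainder
   that is uniform on compact subsets of the ball.  A converse of Taylor's theorem
   (compare the expansions at [z] and at [z + t e_j]) then shows
   [d/dz_j (a z al) = (al_j + 1) (a z (al + e_j))], which identifies
   [a z al] with the mixed partial derivative divided by [al!]. *)

(** * Euclidean norms *)

Section L2Norm.
Variable C : numClosedFieldType.
Implicit Types I : finType.

Definition l2 I (f : I -> C) : C := sqrtC (\sum_i `|f i| ^+ 2).

Lemma sum_sqr_norm_ge0 I (f : I -> C) : 0 <= \sum_i `|f i| ^+ 2.
Proof. by apply: sumr_ge0 => i _; rewrite exprn_ge0. Qed.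

Lemma l2_ge0 I (f : I -> C) : 0 <= l2 f.
Proof. by rewrite /l2 sqrtC_ge0 sum_sqr_norm_ge0. Qed.

Lemma l2_sqr I (f : I -> C) : l2 f ^+ 2 = \sum_i `|f i| ^+ 2.
Proof. by rewrite /l2 sqrtCK. Qed.

Lemma ler_sqr_ge0 (x y : C) : 0 <= x -> 0 <= y -> x ^+ 2 <= y ^+ 2 -> x <= y.
Proof. by move=> x0 y0; rewrite ler_pXn2r. Qed.

(** After the triangle inequality only the moduli [a i] and [b i] matter. The sum of the squares of
    [B a_i - c b_i] is nonnegative and expands to [B (A B - c^2)]; dividing by [B] requires the case
    [B = 0] to be treated apart. *)
Lemma cauchy_schwarz I (f g : I -> C) : `|\sum_i f i * g i| <= l2 f * l2 g.
Proof.
set a := fun i => `|f i|; set b := fun i => `|g i|.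
have a0 i : 0 <= a i by rewrite normr_ge0.
have b0 i : 0 <= b i by rewrite normr_ge0.
apply: (le_trans (ler_norm_sum _ _ _)).
under eq_bigr do rewrite normrM -/(a _) -/(b _).
set c := \sum_i _.
have c0 : 0 <= c by apply: sumr_ge0 => i _; rewrite mulr_ge0.
apply: ler_sqr_ge0; rewrite ?mulr_ge0 ?l2_ge0 // exprMn !l2_sqr.
rewrite -/(a _) -/(b _).
set A := \sum_i `|f i| ^+ 2; set B := \sum_i `|g i| ^+ 2.
have A0 : 0 <= A by exact: sum_sqr_norm_ge0.
have : 0 <= B by exact: sum_sqr_norm_ge0.
rewrite le0r => /orP[/eqP B0|B0].
  have g0 i : b i = 0.
    apply/eqP; rewrite -sqrf_eq0; apply/eqP.
    by move/psumr_eq0P: B0 => -> // j _; rewrite exprn_ge0.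
  rewrite B0 mulr0 /c big1 ?expr0n // => i _.
  by rewrite g0 mulr0.
have : 0 <= \sum_i (B * a i - c * b i) ^+ 2.
  apply: sumr_ge0 => i _; rewrite -realEsqr.
  by rewrite realB ?realM ?ger0_real // ltW.
have -> : \sum_i (B * a i - c * b i) ^+ 2 = B * (A * B - c ^+ 2).
  transitivity (\sum_i (B ^+ 2 * a i ^+ 2 - B * c *+ 2 * (a i * b i)
      + c ^+ 2 * b i ^+ 2)).
    apply: eq_bigr => i _; rewrite sqrrB !exprMn.
    by congr (_ - _ + _); rewrite mulrnAl; congr (_ *+ _); rewrite mulrACA mulrA.
  rewrite big_split sumrB /= -!mulr_sumr -/c -/A -/B.
  rewrite mulrnAl mulrBr !expr2 mulr2n.
  rewrite opprD (mulrC (c * c)) -!mulrA (mulrC B A).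
  by rewrite addrA subrK.
by rewrite pmulr_rge0 // subr_ge0.
Qed.

Lemma ler_l2 I (f g : I -> C) : (forall i, `|f i| <= `|g i|) -> l2 f <= l2 g.
Proof.
move=> fg; apply: ler_sqr_ge0; rewrite ?l2_ge0 // !l2_sqr.
by apply: ler_sum => i _; rewrite ler_pXn2r ?nnegrE.
Qed.

Lemma ler_l2D I (f g : I -> C) : l2 (fun i => f i + g i) <= l2 f + l2 g.
Proof.
apply: ler_sqr_ge0; rewrite ?addr_ge0 ?l2_ge0 //.
rewrite sqrrD l2_sqr !l2_sqr.
have -> : l2 f * l2 g = l2 (fun i => `|f i|) * l2 (fun i => `|g i|).
  by rewrite /l2; congr (sqrtC _ * sqrtC _); apply: eq_bigr => i _;
     rewrite normr_id.
apply: (@le_trans _ _ (\sum_i (`|f i| ^+ 2 + (`|f i| * `|g i|) *+ 2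
    + `|g i| ^+ 2))).
  by apply: ler_sum => i _; rewrite -sqrrD ler_pXn2r ?nnegrE ?addr_ge0 // ler_normD.
rewrite 2!big_split sumrMnl lerD2r lerD2l lerMn2r.
have := cauchy_schwarz (fun i => `|f i|) (fun i => `|g i|).
by rewrite ger0_norm // sumr_ge0 // => i _; rewrite mulr_ge0.
Qed.

Lemma l2Z I (a : C) (f : I -> C) : l2 (fun i => a * f i) = `|a| * l2 f.
Proof.
rewrite /l2; under eq_bigr do rewrite normrM exprMn.
by rewrite -mulr_sumr sqrtCM ?nnegrE ?exprn_ge0 ?sum_sqr_norm_ge0 //
   sqrCK.
Qed.

Lemma l2_eq0 I (f : I -> C) : l2 f = 0 -> forall i, f i = 0.
Proof.
move=> /eqP; rewrite /l2 sqrtC_eq0 => /eqP /psumr_eq0P f0 i.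
by apply/eqP; rewrite -normr_eq0 -sqrf_eq0 f0.
Qed.

Lemma ler_norm_l2 I (f : I -> C) i : `|f i| <= l2 f.
Proof.
apply: ler_sqr_ge0; rewrite ?l2_ge0 // l2_sqr (bigD1 i) //= lerDl.
by apply: sumr_ge0 => j _; rewrite exprn_ge0.
Qed.

Definition cnorm m (x : 'cV[C]_m) : C := l2 (fun i => x i 0).
Definition rnorm m (x : 'rV[C]_m) : C := l2 (fun i => x 0 i).

Lemma cnorm_ge0 m (x : 'cV[C]_m) : 0 <= cnorm x. Proof. exact: l2_ge0. Qed.
Lemma rnorm_ge0 m (x : 'rV[C]_m) : 0 <= rnorm x. Proof. exact: l2_ge0. Qed.

Lemma cnorm0 m : cnorm (0 : 'cV[C]_m) = 0.
Proof. by rewrite /cnorm /l2 big1 ?sqrtC0 // => i _; rewrite mxE normr0 expr0n. Qed.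

Lemma cnorm_eq0 m (x : 'cV[C]_m) : cnorm x = 0 -> x = 0.
Proof. by move/l2_eq0 => x0; apply/colP => i; rewrite x0 mxE. Qed.

Lemma ler_cnormD m (x y : 'cV[C]_m) : cnorm (x + y) <= cnorm x + cnorm y.
Proof.
apply: le_trans (ler_l2D _ _).
by apply: ler_l2 => i; rewrite mxE.
Qed.

Lemma cnormZ m a (x : 'cV[C]_m) : cnorm (a *: x) = `|a| * cnorm x.
Proof.
by rewrite -l2Z; rewrite /cnorm /l2; under eq_bigr do rewrite mxE.
Qed.

Lemma ler_cnorm_comb m (I : finType) (a : I -> C) (x : I -> 'cV[C]_m) :
  cnorm (\sum_i a i *: x i) <= l2 a * l2 (fun i => cnorm (x i)).
Proof.
apply: (@le_trans _ _ (\sum_i `|a i| * cnorm (x i))).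
  elim/big_ind2: _ => [|u1 u2 v1 v2 h1 h2|i _]; rewrite ?cnorm0 ?cnormZ //.
  exact: le_trans (ler_cnormD _ _) (lerD h1 h2).
have := cauchy_schwarz (fun i => `|a i|) (fun i => cnorm (x i)).
rewrite ger0_norm; last by apply: sumr_ge0 => i _; rewrite mulr_ge0 ?cnorm_ge0.
move=> /le_trans; apply; rewrite le_eqVlt; apply/orP; left; apply/eqP.
by congr (_ * _); rewrite /l2; under eq_bigr do rewrite normr_id.
Qed.

Lemma ler_norm_mulmx m (g : 'rV[C]_m) (x : 'cV[C]_m) :
  `|(g *m x) 0 0| <= rnorm g * cnorm x.
Proof. by rewrite mxE; exact: cauchy_schwarz. Qed.

End L2Norm.

(** * Finite-dimensional realizations *)

Section Realization.
Variable C : numClosedFieldType.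
Local Open Scope sesquilinear_scope.

Lemma adjmxM m n p (X : 'M[C]_(m, n)) (Y : 'M[C]_(n, p)) :
  (X *m Y)^t* = Y^t* *m X^t*.
Proof. by rewrite trmx_mul map_mxM. Qed.

Lemma sqr_cnorm m (x : 'cV[C]_m) : cnorm x ^+ 2 = (x^t* *m x) 0 0.
Proof.
rewrite l2_sqr mxE; apply: eq_bigr => i _.
by rewrite !mxE normCK mulrC.
Qed.

Lemma rnorm_adj m (x : 'cV[C]_m) : rnorm (x^t*) = cnorm x.
Proof. by rewrite /rnorm /cnorm /l2; under eq_bigr do rewrite !mxE norm_conjC. Qed.

(** Spectral theorem: [K] is unitarily diagonalizable, and testing positivity on the rows of [V]
    shows that the eigenvalues are nonnegative. [G] is the adjoint of [V] times the square root of
    the diagonal. *)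
Lemma gram_factorization k (K : 'M[C]_k) :
  (forall i j, K j i = (K i j)^*) ->
  (forall c : 'I_k -> C, 0 <= \sum_i \sum_j c i * (c j)^* * K i j) ->
  exists G : 'M[C]_k, K = G *m G^t*.
Proof.
move=> Kherm Kpsd.
have /hermitian_normalmx /orthomx_spectralP : K \is hermsymmx.
  apply/is_hermitianmxP; rewrite expr0 scale1r.
  by apply/matrixP => i j; rewrite !mxE; exact: Kherm.
set V := spectralmx K; set D := spectral_diag K => KE.
have Vu : V \is unitarymx by exact: spectral_unitarymx.
rewrite invmx_unitary // in KE.
have VV : V *m V^t* = 1%:M by exact/unitarymxP.
have D0 i : 0 <= D 0 i.
  have -> : D 0 i = (V *m K *m V^t*) i i.
    by rewrite KE !mulmxA VV mul1mx -mulmxA VV mulmx1 !mxE eqxx mulr1n.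
  have := Kpsd (fun j => V i j).
  rewrite mxE exchange_big /=; under eq_bigr => j _.
    have -> : \sum_i0 V i i0 * (V i j)^* * K i0 j = (V *m K) i j * V^t* j i.
      rewrite !mxE mulr_suml; apply: eq_bigr => l _.
      by rewrite -!mulrA; congr (_ * _); rewrite mulrC.
    over.
  by [].
exists (V^t* *m diag_mx (\row_i sqrtC (D 0 i))).
rewrite adjmxM trmxCK mulmxA -[in RHS](mulmxA (V^t*)) {1}KE.
congr (_ *m _ *m _); rewrite tr_diag_mx map_diag_mx mulmx_diag.
congr diag_mx; apply/rowP => i; rewrite !mxE.

by rewrite /= geC0_conj ?sqrtC_ge0 // -expr2 sqrtCK.
Qed.

Lemma mulmx_adj_eq0 m n (X : 'M[C]_(m, n)) : X^t* *m X = 0 -> X = 0.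
Proof.
move=> X0; apply/matrixP => i j; rewrite mxE.
suff /cnorm_eq0 /colP/(_ i) : cnorm (col j X) = 0 by rewrite !mxE.
apply/eqP; rewrite -sqrf_eq0 sqr_cnorm; apply/eqP.
move/matrixP/(_ j j): X0; rewrite !mxE => X0; rewrite -[RHS]X0.
by apply: eq_bigr => l _; rewrite !mxE.
Qed.

(** The adjoint of [P] vanishes on the kernel of [G], so its rows lie in the row space of [G] and a
    pseudo-inverse of [G] recovers it; taking adjoints moves the pseudo-inverse to the other
    side. *)
Lemma gram_right_inverse k m (P : 'M[C]_(k, m)) :
  exists M : 'M[C]_k, P *m P^t* *m M *m P = P.
Proof.
set G := P *m P^t*.
have Gh : G^t* = G by rewrite adjmxM trmxCK.
have sub : (P^t* <= G)%MS.
  rewrite submxE; apply/eqP; apply: mulmx_adj_eq0.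
  by rewrite adjmxM trmxCK -mulmxA (mulmxA P) mulmx_coker mulmx0.
exists ((pinvmx G)^t*).
by have /(congr1 (fun X => X^t*)) := mulmxKpV sub; rewrite adjmxM Gh adjmxM trmxCK mulmxA.
Qed.

Lemma cdotC d (z w : 'rV[C]_d) : (cdot z w)^* = cdot w z.
Proof.
rewrite /cdot rmorph_sum; apply: eq_bigr => i _.
by rewrite rmorphM /= conjCK mulrC.
Qed.

Lemma enormE d (z : 'rV[C]_d) : enorm z = rnorm z.
Proof. by congr sqrtC; apply: eq_bigr => i _; rewrite normCK. Qed.

Lemma unit_ballE d (z : 'rV[C]_d) : unit_ball z = (enorm z < 1) :> Prop.
Proof.
rewrite enormE /unit_ball /=; congr is_true.
by rewrite -[in RHS](ltr_pXn2r (n := 2)) ?nnegrE ?rnorm_ge0 // l2_sqr expr1n.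
Qed.

Lemma norm_cdot_lt1 d (z w : 'rV[C]_d) :
  unit_ball z -> unit_ball w -> `|cdot z w| < 1.
Proof.
rewrite !unit_ballE !enormE => z1 w1.
apply: le_lt_trans (cauchy_schwarz _ _) _.
have -> : l2 (fun i => (w 0 i)^*) = rnorm w.
  by rewrite /rnorm /l2; under eq_bigr do rewrite norm_conjC.
by rewrite mulr_ilt1 ?rnorm_ge0.
Qed.

Lemma one_sub_cdot_neq0 d (z w : 'rV[C]_d) :
  unit_ball z -> unit_ball w -> 1 - cdot z w != 0.
Proof.
move=> z1 w1; apply/eqP => /eqP; rewrite subr_eq0 => /eqP zw.
by have := norm_cdot_lt1 z1 w1; rewrite -zw normr1 ltxx.
Qed.

Lemma cnorm_col_mx m n (x : 'cV[C]_m) (y : 'cV[C]_n) :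
  cnorm (col_mx x y) ^+ 2 = cnorm x ^+ 2 + cnorm y ^+ 2.
Proof.
rewrite !l2_sqr big_split_ord; congr (_ + _); apply: eq_bigr => i _.
  by rewrite col_mxEu.
by rewrite col_mxEd.
Qed.

(* The vectors [(g i, p i)] and [((w i 0 j *: g i)_j, 1)] have the same Gram matrix
   [Gm], so the second family is carried to the first by a partial isometry; [M] plays
   the role of a pseudo-inverse of [Gm]. *)
Lemma finite_realization d k (w : 'I_k -> 'rV[C]_d) (p : 'I_k -> C)
    (K := fun i j => (1 - p i * (p j)^*) / (1 - cdot (w i) (w j))) :
  (forall i, unit_ball (w i)) ->
  (forall c : 'I_k -> C, 0 <= \sum_i \sum_j c i * (c j)^* * K i j) ->
  exists m (g : 'I_k -> 'rV[C]_m) (A : 'I_d -> 'M[C]_m) (B : 'I_d -> 'cV[C]_m)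
    (c : 'rV[C]_m) (e : C),
  [/\ forall i, g i = \sum_j w i 0 j *: (g i *m A j) + c,
      forall i, p i = \sum_j w i 0 j * (g i *m B j) 0 0 + e,
      forall i, rnorm (g i) ^+ 2 = K i i &
      forall (x : 'cV_m) t, \sum_j cnorm (A j *m x + t *: B j) ^+ 2
        + `|(c *m x) 0 0 + e * t| ^+ 2 <= cnorm x ^+ 2 + `|t| ^+ 2].
Proof.
move=> w1 Kpsd; pose KM : 'M[C]_k := \matrix_(i, j) K i j.
have [G KG] : exists G : 'M[C]_k, KM = G *m G^t*.
  apply: gram_factorization => [i j|c].
    rewrite !mxE /K fmorph_div !rmorphB rmorph1 /= rmorphM /= conjCK cdotC.
    by rewrite (mulrC (p j)).
  rewrite (_ : \sum_i _ = \sum_i \sum_j c i * (c j)^* * K i j) //.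
  by apply: eq_bigr => i _; apply: eq_bigr => j _; rewrite mxE.
pose f : 'cV_k := \col_i p i.
pose one : 'cV[C]_k := const_mx 1.
have [S SE] : exists S : 'I_d -> 'M[C]_k, forall j, S j = diag_mx (\row_i w i 0 j) *m G.
  by exists (fun j => diag_mx (\row_i w i 0 j) *m G).
pose P := row_mx G f.
have [M MP] := gram_right_inverse P.
have [Gm GmP] : exists Gm, Gm = P *m P^t* by exists (P *m P^t* ).
rewrite -GmP in MP.
(* The identity [K i j * (1 - <w_i, w_j>) = 1 - p_i (p_j)^*] with the negative terms moved across:
   each side is the Gram matrix of one of the two families. *)
have GmE : Gm = \sum_j S j *m (S j)^t* + one *m one^t*.
  rewrite GmP /P tr_row_mx map_col_mx mul_row_col -KG.
  apply/matrixP => i j; rewrite [LHS]mxE [RHS]mxE summxE.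
  under eq_bigr => l _.
    have -> : (S l *m (S l)^t*) i j = w i 0 l * (w j 0 l)^* * K i j.
      rewrite SE adjmxM !mulmxA -(mulmxA (diag_mx _)) -KG tr_diag_mx.
      rewrite map_diag_mx mul_mx_diag mul_diag_mx !mxE /=.
      by rewrite mulrAC.
    over.
  rewrite -mulr_suml -/(cdot (w i) (w j)) !mxE !big_ord1 !mxE rmorph1 mulr1.
  have KE : K i j * (1 - cdot (w i) (w j)) = 1 - p i * (p j)^*.
    by rewrite /K divfK ?one_sub_cdot_neq0.
  apply/eqP; rewrite -subr_eq0; apply/eqP.
  by move/eqP: KE; rewrite -subr_eq0 => /eqP <-; ring.
have MG : Gm *m M *m G = G.
  by move/(congr1 lsubmx): MP; rewrite mul_mx_row /P !row_mxKl.
have Mf : Gm *m M *m f = f.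
  by move/(congr1 rsubmx): MP; rewrite mul_mx_row /P !row_mxKr.
have row_S n i j (Y : 'M[C]_(k, n)) : row i (S j *m Y) = w i 0 j *: (row i G *m Y).
  apply/rowP => l; rewrite SE -mulmxA mul_diag_mx !mxE.
  by congr (_ * _); apply: eq_bigr => r _; rewrite mxE.
exists k, (fun i => row i G), (fun j => (S j)^t* *m M *m G),
  (fun j => (S j)^t* *m M *m f), (one^t* *m M *m G), ((one^t* *m M *m f) 0 0).
split=> [i|i|i|x t].
- rewrite -[in LHS]MG GmE !mulmxDl !linearD /= !mulmx_suml linear_sum /=.
  congr (_ + _); first by apply: eq_bigr => j _; rewrite -!mulmxA row_S.
  rewrite -!mulmxA; apply/rowP => l; rewrite !mxE big_ord1 !mxE mul1r.
  by [].
- have -> : p i = (Gm *m M *m f) i 0 by rewrite Mf mxE.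
  rewrite GmE !mulmxDl !mulmx_suml mxE summxE; congr (_ + _).
    apply: eq_bigr => j _; rewrite -!mulmxA.
    by move/rowP/(_ 0): (row_S _ i j ((S j)^t* *m (M *m f))); rewrite !mxE.
  by rewrite -!mulmxA mxE big_ord1 mxE mul1r.
- rewrite l2_sqr; have -> : K i i = KM i i by rewrite mxE.
  by rewrite KG mxE; apply: eq_bigr => l _; rewrite !mxE normCK.
have [v vE0] : exists v, v = M *m (G *m x + t *: f) by eexists.
have -> : \sum_j cnorm ((S j)^t* *m M *m G *m x + t *: ((S j)^t* *m M *m f)) ^+ 2
   = \sum_j cnorm ((S j)^t* *m v) ^+ 2.
  apply: eq_bigr => j _; congr (cnorm _ ^+ 2).
  by rewrite vE0 !mulmxDr -!scalemxAr !mulmxA.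
have -> : (one^t* *m M *m G *m x) 0 0 + (one^t* *m M *m f) 0 0 * t
   = (one^t* *m v) 0 0.
  by rewrite vE0 !mulmxDr -!scalemxAr !mulmxA !mxE mulrC.
have vE : cnorm (P^t* *m v) ^+ 2 =
    \sum_j cnorm ((S j)^t* *m v) ^+ 2 + `|(one^t* *m v) 0 0| ^+ 2.
  rewrite sqr_cnorm adjmxM trmxCK mulmxA -(mulmxA _ P) -GmP GmE.
  rewrite mulmxDr mulmxDl mxE mulmx_sumr mulmx_suml summxE; congr (_ + _).
    apply: eq_bigr => j _; rewrite sqr_cnorm adjmxM trmxCK.
    by rewrite !mulmxA.
  rewrite -!mulmxA mulmxA mxE big_ord1 normCK mulrC.
  by congr (_ * _); rewrite -[X in (_ *m X) _ _](trmxCK one) -adjmxM mxE mxE.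
rewrite -vE.
pose y := col_mx x (t%:M : 'cV_1).
have -> : cnorm x ^+ 2 + `|t| ^+ 2 = cnorm y ^+ 2.
  by rewrite cnorm_col_mx [X in _ = _ + X]l2_sqr big_ord1 !mxE eqxx mulr1n.
have vPy : v = M *m (P *m y).
  by rewrite vE0 /P /y mul_row_col mul_mx_scalar.
(* [Gm *m M *m P = P] gives [P P^t* v = P y], so the squared norm is the inner product of [P^t* v]
   with [y]. After Cauchy-Schwarz one factor cancels. *)
have vle : cnorm (P^t* *m v) ^+ 2 <= cnorm (P^t* *m v) * cnorm y.
  have vP : cnorm (P^t* *m v) ^+ 2 = ((P^t* *m v)^t* *m y) 0 0.
    rewrite sqr_cnorm adjmxM trmxCK mulmxA -(mulmxA _ P) -GmP.
    by rewrite {2}vPy -mulmxA (mulmxA Gm) (mulmxA _ P) MP mulmxA.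
  rewrite -(ger0_norm (_ : 0 <= cnorm (P^t* *m v) ^+ 2)) ?exprn_ge0 ?cnorm_ge0 //.
  by rewrite {1}vP (le_trans (ler_norm_mulmx _ _)) // rnorm_adj.
have : 0 <= cnorm (P^t* *m v) by exact: cnorm_ge0.
rewrite le0r => /orP[/eqP->|v0]; first by rewrite expr0n exprn_ge0 ?cnorm_ge0.
by rewrite ler_pXn2r ?nnegrE ?cnorm_ge0 //; rewrite expr2 ler_pM2l in vle.
Qed.

End Realization.

(** * Words and Taylor polynomials *)

Section Words.
Variables (C : numClosedFieldType) (d : nat).
Implicit Types (s : seq 'I_d) (h : 'rV[C]_d).

Definition mdeg (a : 'I_d -> nat) : nat := (\sum_i a i)%N.

Definition content s : 'I_d -> nat := fun i => count_mem i s.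

Fixpoint words k : seq (seq 'I_d) :=
  if k is k'.+1 then [seq j :: s | j <- enum 'I_d, s <- words k'] else [:: [::]].

Lemma size_words k : size (words k) = (d ^ k)%N.
Proof.
elim: k => //= k IH.
by rewrite size_allpairs IH size_enum_ord expnS.
Qed.

Lemma big_words (V : nmodType) k (F : seq 'I_d -> V) :
  \sum_(s <- words k.+1) F s = \sum_j \sum_(s <- words k) F (j :: s).
Proof. by rewrite /= big_allpairs_dep /= big_enum. Qed.

Lemma mem_words k s : (s \in words k) = (size s == k).
Proof.
elim: k s => [|k IH] s /=; first by rewrite inE; case: s.
apply/allpairsPdep/idP => [[j [t [_ + ->]]]|]; first by rewrite IH.
case: s => // j t; rewrite eqSS -IH => ht.
by exists j, t; rewrite mem_enum.
Qed.

Lemma mdeg_content s : mdeg (content s) = size s.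
Proof.
rewrite /mdeg /content; elim: s => [|j s IH] /=; first by rewrite big1.
rewrite big_split /= IH (bigD1 j) //= eqxx big1 ?addn0 //.
by move=> i /negbTE; rewrite eq_sym => ->.
Qed.

Lemma monomial_content h s : monomial h (content s) = \prod_(j <- s) h 0 j.
Proof.
rewrite /monomial /content; elim: s => [|j s IH] /=.
  by rewrite big_nil big1.
rewrite big_cons -IH; under eq_bigr do rewrite exprD.
rewrite big_split /= (bigD1 j) //= eqxx expr1 big1 ?mulr1 //.
by move=> i /negbTE; rewrite eq_sym => ->.
Qed.

(** Every multi-index of degree at most [N] lies in the box [[0, N]^d]; the box only makes the index
    type finite. *)
Definition tpoly N (a : ('I_d -> nat) -> C) h : C :=
  \sum_(k : {ffun 'I_d -> 'I_N.+1} | (mdeg (fun i => k i) <= N)%N)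
     a (fun i => k i) * monomial h (fun i => k i).

Lemma content_leq_size s i : (content s i <= size s)%N.
Proof. exact: count_size. Qed.

(** Words are grouped by content: a pair of [s] and [j] contributes to exactly one multi-index, of
    degree [size s + 1]. Content ignores order, so the distinguished letter [j] may stand at the
    head although it comes last in the matrix products. *)
Lemma tpoly_words N (x0 : C) (b : seq 'I_d -> 'I_d -> C) h
  (a := fun al => if mdeg al == 0%N then x0 else
     \sum_(s <- words (mdeg al).-1) \sum_(j | [forall i, content (j :: s) i == al i]) b s j) :
  tpoly N a h = x0 + \sum_(k < N) \sum_(s <- words k) \sum_j
    monomial h (content (j :: s)) * b s j.
Proof.
rewrite /tpoly; pose z0 : {ffun 'I_d -> 'I_N.+1} := [ffun=> ord0].
have mdz0 : mdeg (fun i => z0 i) = 0%N by rewrite /mdeg big1 // => i _; rewrite ffunE.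
rewrite (bigD1 z0) /=; last by rewrite mdz0.
congr (_ + _).
  rewrite /a mdz0 eqxx /monomial big1 ?mulr1 // => i _.
  by rewrite ffunE expr0.
have mdeg0 (k : {ffun 'I_d -> 'I_N.+1}) : (k != z0) = (0 < mdeg (fun i => k i))%N.
  rewrite lt0n; congr (~~ _); apply/eqP/eqP => [->|]; first exact: mdz0.
  rewrite /mdeg => /eqP; rewrite sum_nat_eq0 => /forallP k0.
  by apply/ffunP => i; apply/val_inj; rewrite ffunE; apply/eqP/k0.
pose P (k : {ffun 'I_d -> 'I_N.+1}) s j := [forall i, content (j :: s) i == k i].
have PE k s j : P k s j -> content (j :: s) = (fun i => k i).
  by move=> /forallP Pk; apply/funext => i; apply/eqP/Pk.
transitivity (\sum_(k : {ffun 'I_d -> 'I_N.+1} |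
    (mdeg (fun i => k i) <= N)%N && (k != z0))
    \sum_(l < N) \sum_(s <- words l) \sum_j
      (if P k s j then monomial h (content (j :: s)) * b s j else 0)).
  apply: eq_bigr => k /andP[kN]; rewrite mdeg0 => k0.
  rewrite /a gtn_eqF //.
  have kN' : ((mdeg (fun i => k i)).-1 < N)%N by rewrite prednK.
  rewrite (bigD1 (Ordinal kN')) //= [X in _ = _ + X]big1 ?addr0; last first.
    move=> l lk; rewrite big_seq big1 // => s; rewrite mem_words => /eqP sl.
    rewrite big1 // => j _; case: ifP => // /PE sk.
    case/eqP: lk; apply/val_inj => /=.
    by rewrite -sk mdeg_content /= sl.
  rewrite mulr_suml; apply: eq_bigr => s _.
  rewrite mulr_suml big_mkcond; apply: eq_bigr => j _.
  rewrite -/(P k s j); case: ifP => // /PE ->.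
  by rewrite mulrC.
rewrite exchange_big; apply: eq_bigr => l _ /=.
rewrite exchange_big big_seq [RHS]big_seq; apply: eq_bigr => s /=.
rewrite mem_words => /eqP sl.
rewrite exchange_big; apply: eq_bigr => j _ /=.
have cN i : (content (j :: s) i < N.+1)%N.
  by rewrite ltnS (leq_trans (content_leq_size _ _)) //= sl.
pose k : {ffun 'I_d -> 'I_N.+1} := [ffun i => Ordinal (cN i)].
have kE : (fun i => k i : nat) = content (j :: s).
  by apply/funext => i; rewrite ffunE.
have Pk : P k s j by apply/forallP => i; rewrite -kE.
rewrite (bigD1 k) /=; last by rewrite mdeg0 kE mdeg_content /= sl ltn_ord.
rewrite Pk big1 ?addr0 // => k' /andP[_ k'k].
case: ifP => // /PE Pk'; case/eqP: k'k; apply/ffunP => i; apply/val_inj.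
by move/(congr1 (fun f => f i)): (etrans kE Pk') => /= ->.
Qed.

End Words.

(** * Taylor expansion of a transfer function at a point of the ball *)

Section Expansion.
Variables (C : numClosedFieldType) (d m : nat).
Variables (A : 'I_d -> 'M[C]_m) (B : 'I_d -> 'cV[C]_m) (c : 'rV[C]_m) (e : C).
Hypothesis contr : forall (x : 'cV[C]_m) t,
  \sum_j cnorm (A j *m x + t *: B j) ^+ 2 + `|(c *m x) 0 0 + e * t| ^+ 2
    <= cnorm x ^+ 2 + `|t| ^+ 2.
Variable z : 'rV[C]_d.
Hypothesis z1 : unit_ball z.

Let r := rnorm z.
Let kappa := (1 - r)^-1.
Let L := \sum_j z 0 j *: A j.
Let R := invmx (1%:M - L).

Let r1 : 0 < 1 - r.
Proof. by rewrite subr_gt0; move: z1; rewrite unit_ballE enormE. Qed.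

Let kappa0 : 0 <= kappa. Proof. by rewrite invr_ge0 ltW. Qed.

Let contrA (x : 'cV[C]_m) : l2 (fun j => cnorm (A j *m x)) <= cnorm x.
Proof.
apply: ler_sqr_ge0; rewrite ?l2_ge0 // l2_sqr.
have := contr x 0; rewrite normr0 expr0n addr0 /=; apply: le_trans.
rewrite ler_wpDr ?exprn_ge0 //; apply: ler_sum => j _.
by rewrite scale0r addr0 ger0_norm ?cnorm_ge0.
Qed.

(** Cauchy-Schwarz in [j] together with [contrA] gives [|L x| <= r |x|], whence
    [(1 - r) |x| <= |y|]. *)
Let resolvent_bound (x y : 'cV[C]_m) : x = y + L *m x -> cnorm x <= kappa * cnorm y.
Proof.
move=> xE; rewrite mulrC ler_pdivlMr // mulrBr mulr1 lerBlDr {1}xE.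
apply: le_trans (ler_cnormD _ _) _; rewrite lerD2l /L mulmx_suml.
under eq_bigr do rewrite -scalemxAl.
apply: le_trans (ler_cnorm_comb _ _) _; rewrite mulrC.
by rewrite ler_wpM2r ?l2_ge0.
Qed.

Let unitR : 1%:M - L \in unitmx.
Proof.
rewrite -unitmx_tr -row_free_unit -kermx_eq0; apply/eqP/row_matrixP => i.
have := mulmx_ker (1%:M - L)^T => /(congr1 (row i)); rewrite row_mul !row0.
set v := row i _ => /(congr1 trmx); rewrite trmx_mul trmxK trmx0.
rewrite mulmxBl mul1mx => /eqP; rewrite subr_eq0 => /eqP vE.
have /resolvent_bound : v^T = 0 + L *m v^T by rewrite add0r.
rewrite cnorm0 mulr0 => v0; apply: trmx_inj; rewrite trmx0.
by apply: cnorm_eq0; apply/eqP; rewrite eq_le v0 cnorm_ge0.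
Qed.

Let RE (x : 'cV[C]_m) : R *m x = x + L *m (R *m x).
Proof.
apply/eqP; rewrite -subr_eq -{1}(mul1mx (R *m x)) -mulmxBl mulmxA.
by rewrite mulmxV // mul1mx.
Qed.

(** The letters of the expansion: for [w = z + h], the state row satisfies
    [g = gz + g *m \sum_j h_j X_j] and the value is [pw = pz + g *m \sum_j h_j T_j]. *)
Let X j := A j *m R.
Let T j := A j *m (R *m \sum_j z 0 j *: B j) + B j.

Let contrX (x : 'cV[C]_m) : l2 (fun j => cnorm (X j *m x)) <= kappa * cnorm x.
Proof.
under [X in l2 X]eq_fun do rewrite -mulmxA.
exact: le_trans (contrA _) (resolvent_bound (RE x)).
Qed.

(** Both equations can be solved for [c]: [gz (1 - L) = c = g (1 - L - \sum_j h_j A_j)]. Multiplying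
    on the right by [R] gives the claim. *)
Lemma row_shift (g gz : 'rV[C]_m) (w h : 'rV[C]_d) : w = z + h ->
  gz = \sum_j z 0 j *: (gz *m A j) + c ->
  g = \sum_j w 0 j *: (g *m A j) + c ->
  g = gz + g *m \sum_j h 0 j *: X j.
Proof.
move=> -> gzE gE.
have cE : c = gz *m (1%:M - L).
  rewrite mulmxBr mulmx1 {1}gzE /L mulmx_sumr.
  under [X in _ - X]eq_bigr do rewrite -scalemxAr.
  by rewrite addrAC subrr add0r.
have gL : g *m (1%:M - L) = g *m (\sum_j h 0 j *: A j) + gz *m (1%:M - L).
  rewrite -cE mulmxBr mulmx1 {1}gE /L !mulmx_sumr.
  under [X in _ - X]eq_bigr do rewrite -scalemxAr.
  under [X in _ = X + _]eq_bigr do rewrite -scalemxAr.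
  have -> : \sum_j (z + h) 0 j *: (g *m A j) =
      \sum_j z 0 j *: (g *m A j) + \sum_j h 0 j *: (g *m A j).
    by rewrite -big_split; apply: eq_bigr => j _; rewrite mxE scalerDl.
  by rewrite -2!addrA [LHS]addrC -addrA subrK.
rewrite -[LHS](mulmxK unitR) gL mulmxDl mulmxK // addrC -mulmxA; congr (_ + _ *m _).
by rewrite mulmx_suml; apply: eq_bigr => j _; rewrite -scalemxAl.
Qed.

Lemma transfer_shift (g gz : 'rV[C]_m) (w h : 'rV[C]_d) (pw pz : C) :
  w = z + h ->
  gz = \sum_j z 0 j *: (gz *m A j) + c ->
  g = \sum_j w 0 j *: (g *m A j) + c ->
  pz = \sum_j z 0 j * (gz *m B j) 0 0 + e ->
  pw = \sum_j w 0 j * (g *m B j) 0 0 + e ->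
  pw = pz + (g *m \sum_j h 0 j *: T j) 0 0.
Proof.
move=> wE gzE gE pzE pwE.
have gg := row_shift wE gzE gE.
have sumB (y : 'rV[C]_m) (v : 'rV[C]_d) :
    \sum_j v 0 j * (y *m B j) 0 0 = (y *m \sum_j v 0 j *: B j) 0 0.
  rewrite mulmx_sumr summxE; apply: eq_bigr => j _.
  by rewrite -scalemxAr [RHS]mxE.
have -> : \sum_j h 0 j *: T j =
    (\sum_j h 0 j *: X j) *m (\sum_j z 0 j *: B j) + \sum_j h 0 j *: B j.
  rewrite mulmx_suml -big_split; apply: eq_bigr => j _ /=.
  by rewrite /T scalerDr -scalemxAl /X mulmxA.
have gX : g *m (\sum_j h 0 j *: X j) = g - gz.
  by rewrite [X in _ = X - _]gg addrAC subrr add0r.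
have wE' : \sum_j w 0 j *: B j = \sum_j z 0 j *: B j + \sum_j h 0 j *: B j.
  by rewrite -big_split wE; apply: eq_bigr => j _; rewrite mxE scalerDl.
rewrite pwE pzE !sumB wE' !mulmxDr mulmxA gX mulmxBl.
move: (g *m _) (g *m _) (gz *m _) => a b a'.
by rewrite !mxE; ring.
Qed.

(** Contractivity is applied to the input [(u, 1)] with [u = R \sum_j z_j B_j], whose outputs are
    exactly the [T j] and [pz]. Since also [u = \sum_j z_j T_j], [|u|^2] is at most [r^2] times the
    sum of the [|T_j|^2] and is absorbed on the left. *)
Lemma T_bound (gz : 'rV[C]_m) (pz : C) :
  gz = \sum_j z 0 j *: (gz *m A j) + c ->
  pz = \sum_j z 0 j * (gz *m B j) 0 0 + e ->
  (\sum_j cnorm (T j) ^+ 2) * (1 - r ^+ 2) <= 1 - `|pz| ^+ 2.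
Proof.
move=> gzE pzE; pose u := R *m \sum_j z 0 j *: B j.
have uE : u = \sum_j z 0 j *: T j.
  rewrite {1}/u RE -/u /T -/u addrC mulmx_suml -big_split.
  by apply: eq_bigr => j _ /=; rewrite scalerDr scalemxAl.
have cu : (c *m u) 0 0 + e * 1 = pz.
  have cE : c = gz *m (1%:M - L).
    rewrite mulmxBr mulmx1 {1}gzE /L mulmx_sumr.
    under [X in _ - X]eq_bigr do rewrite -scalemxAr.
    by rewrite addrAC subrr add0r.
  rewrite pzE mulr1 cE /u mulmxA mulmxK // mulmx_sumr summxE.
  by congr (_ + _); apply: eq_bigr => j _; rewrite -scalemxAr [LHS]mxE.
have := contr u 1; rewrite cu normr1 expr1n.
under eq_bigr do rewrite scale1r -/(T _).
set S := \sum_j _ => le1.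
have uS : cnorm u ^+ 2 <= r ^+ 2 * S.
  have -> : S = l2 (fun j => cnorm (T j)) ^+ 2.
    by rewrite l2_sqr; apply: eq_bigr => j _; rewrite ger0_norm ?cnorm_ge0.
  rewrite -exprMn ler_pXn2r ?nnegrE ?mulr_ge0 ?cnorm_ge0 ?l2_ge0 ?rnorm_ge0 //.
  by rewrite {1}uE; exact: ler_cnorm_comb.
rewrite mulrBr mulr1 lerBlDr addrAC lerBrDr.
apply: (le_trans le1); rewrite [leRHS]addrC; apply: lerD => //.
by rewrite (mulrC S).
Qed.

Definition Xs (s : seq 'I_d) : 'M[C]_m := foldr (fun j Y => X j *m Y) 1%:M s.

Lemma exp_words (h : 'rV[C]_d) k : iter k (fun Y => (\sum_j h 0 j *: X j) *m Y) 1%:M =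
  \sum_(s <- words d k) monomial h (content s) *: Xs s.
Proof.
elim: k => [|k IH]; first by rewrite big_seq1 monomial_content big_nil scale1r.
rewrite big_words iterS IH mulmx_suml; apply: eq_bigr => j _.
rewrite mulmx_sumr; apply: eq_bigr => s _.
rewrite -scalemxAl -scalemxAr scalerA !monomial_content big_cons.
by rewrite mulrC.
Qed.

(** Prepending a letter multiplies the sum by at most [kappa^2], because the column formed by all
    the [X j] has norm at most [kappa]. *)
Lemma words_norm k :
  \sum_(s <- words d k) \sum_j cnorm (Xs s *m T j) ^+ 2 <=
  (kappa ^+ 2) ^+ k * \sum_j cnorm (T j) ^+ 2.
Proof.
elim: k => [|k IH].
  by rewrite big_seq1 mul1r; under eq_bigr do rewrite mul1mx.
rewrite big_words exchange_big (exprS (kappa ^+ 2) k) -mulrA.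
have k20 : 0 <= kappa ^+ 2 by rewrite exprn_ge0.
apply: (@le_trans _ _ (kappa ^+ 2 * \sum_(s <- words d k) \sum_j cnorm (Xs s *m T j) ^+ 2)); last by rewrite ler_wpM2l.
rewrite mulr_sumr; apply: ler_sum => s _.
rewrite exchange_big mulr_sumr; apply: ler_sum => j _.
have : l2 (fun i => cnorm (X i *m (Xs s *m T j))) ^+ 2 <=
    (kappa * cnorm (Xs s *m T j)) ^+ 2.
  by rewrite ler_pXn2r ?nnegrE ?mulr_ge0 ?l2_ge0 ?cnorm_ge0.
rewrite exprMn; apply: le_trans; rewrite l2_sqr; apply: ler_sum => i _.
by rewrite ger0_norm ?cnorm_ge0 // /= mulmxA.
Qed.

(** The relation [g = gz + g Y] is substituted into itself [N] times; only the remainder still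
    involves [g]. *)
Lemma row_iter (g gz : 'rV[C]_m) (Y : 'M[C]_m) (y : 'cV[C]_m) N :
  g = gz + g *m Y ->
  (g *m y) 0 0 = \sum_(k < N) (gz *m (iter k (mulmx Y) 1%:M *m y)) 0 0
    + (g *m (iter N (mulmx Y) 1%:M *m y)) 0 0.
Proof.
move=> gE; elim: N => [|N IH]; first by rewrite big_ord0 add0r mul1mx.
rewrite [LHS]IH big_ord_recr /= -addrA; congr (_ + _).
by rewrite {1}gE mulmxDl mxE !mulmxA.
Qed.

Lemma iter_norm (h : 'rV[C]_d) N (y : 'cV[C]_m) :
  cnorm (iter N (mulmx (\sum_j h 0 j *: X j)) 1%:M *m y)
    <= (rnorm h * kappa) ^+ N * cnorm y.
Proof.
elim: N => [|N IH]; first by rewrite mul1r mul1mx.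
rewrite iterS -mulmxA mulmx_suml; under eq_bigr do rewrite -scalemxAl.
apply: le_trans (ler_cnorm_comb _ _) _.
rewrite exprS -!mulrA ler_wpM2l ?l2_ge0 //.
apply: le_trans (contrX _) _.
by rewrite ler_wpM2l.
Qed.

Lemma sum_at_most_one (I : finType) (P : pred I) (x : I -> C) :
  (forall i j, P i -> P j -> i = j) -> `|\sum_(i | P i) x i| <= l2 x.
Proof.
move=> Puniq; case: (pickP P) => [i Pi|P0]; last first.
  by rewrite big_pred0 // normr0 l2_ge0.
rewrite (bigD1 i) //= big1 ?addr0 ?ler_norm_l2 // => j /andP[Pj].
by rewrite (Puniq _ _ Pj Pi) eqxx.
Qed.

Lemma coef_bound (gz : 'rV[C]_m) (al : 'I_d -> nat) k :
  `|\sum_(s <- words d k) \sum_(j | [forall i, content (j :: s) i == al i])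
     (gz *m (Xs s *m T j)) 0 0| <=
  sqrtC d%:R ^+ k * (rnorm gz * (kappa ^+ k * l2 (fun j => cnorm (T j)))).
Proof.
pose P (s : seq 'I_d) (j : 'I_d) := [forall i, content (j :: s) i == al i].
have Puniq s i j : P s i -> P s j -> i = j.
  move=> /forallP Pi /forallP Pj; apply/eqP.
  have := eqP (Pi j); rewrite -(eqP (Pj j)) /content /= eqxx => /eqP.
  by rewrite eqn_add2r; case: (i == j).
pose b s := rnorm gz * l2 (fun j => cnorm (Xs s *m T j)).
apply: (@le_trans _ _ (\sum_(s <- words d k) b s)).
  apply: le_trans (ler_norm_sum _ _ _) _; apply: ler_sum => s _.
  apply: le_trans (sum_at_most_one _ (@Puniq s)) _.
  rewrite /b -[rnorm gz](ger0_norm (rnorm_ge0 _)) -l2Z; apply: ler_l2 => j.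
  rewrite [leRHS]ger0_norm ?mulr_ge0 ?cnorm_ge0 ?rnorm_ge0 //.
  exact: ler_norm_mulmx.
rewrite -mulr_sumr mulrCA ler_wpM2l ?rnorm_ge0 //.
rewrite big_tnth.
pose F (i : 'I_(size (words d k))) :=
  l2 (fun j => cnorm (Xs (tnth (in_tuple (words d k)) i) *m T j)).
(* Cauchy-Schwarz over the [d ^ k] words, against the constant 1, produces the factor
   [sqrtC d ^ k]. *)
have := cauchy_schwarz (fun=> 1) F.
rewrite ger0_norm; last first.
  by apply: sumr_ge0 => i _; rewrite mul1r l2_ge0.
under eq_bigr do rewrite mul1r.
move=> /le_trans; apply; apply: ler_pM; rewrite ?l2_ge0 //.
  rewrite /l2 sumr_const normr1 expr1n card_ord size_words natrX.
  by rewrite rootCX ?ler0n.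
apply: ler_sqr_ge0; rewrite ?mulr_ge0 ?exprn_ge0 ?l2_ge0 //.
rewrite exprMn l2_sqr exprAC.
have -> : l2 (fun j => cnorm (T j)) ^+ 2 = \sum_j cnorm (T j) ^+ 2.
  by rewrite l2_sqr; apply: eq_bigr => j _; rewrite ger0_norm ?cnorm_ge0.
apply: le_trans (words_norm k).
rewrite [leRHS]big_tnth; apply: ler_sum => i _.
rewrite /F ger0_norm ?l2_ge0 // l2_sqr; apply: ler_sum => j _.
by rewrite ger0_norm ?cnorm_ge0.
Qed.

Lemma realization_taylor (gz : 'rV[C]_m) (pz : C) N :
  gz = \sum_j z 0 j *: (gz *m A j) + c ->
  pz = \sum_j z 0 j * (gz *m B j) 0 0 + e ->
  rnorm gz ^+ 2 = (1 - `|pz| ^+ 2) / (1 - r ^+ 2) ->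
  exists a : ('I_d -> nat) -> C,
  [/\ forall al, mdeg al = 0%N -> a al = pz,
      forall al, (0 < mdeg al)%N ->
        `|a al| <= sqrtC d%:R ^+ (mdeg al - 1) *
          ((1 - `|pz| ^+ 2) / ((1 - r ^+ 2) * (1 - r) ^+ (mdeg al - 1))) &
      forall (w : 'rV[C]_d) (g : 'rV[C]_m) pw,
        g = \sum_j w 0 j *: (g *m A j) + c ->
        pw = \sum_j w 0 j * (g *m B j) 0 0 + e ->
        `|pw - tpoly N a (w - z)| <=
          rnorm g * (kappa * rnorm (w - z)) ^+ N.+1].
Proof.
move=> gzE pzE gzn; pose D := 1 - `|pz| ^+ 2; pose q := 1 - r ^+ 2.
have r0 : 0 <= r by exact: rnorm_ge0.
have qE : q = (1 - r) * (1 + r) by rewrite /q; ring.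
have q0 : 0 < q by rewrite qE mulr_gt0 // ltr_wpDr.
pose lT := l2 (fun j => cnorm (T j)).
have lT2 : lT ^+ 2 <= D / q.
  rewrite ler_pdivlMr // (le_trans _ (T_bound gzE pzE)) //.
  rewrite ler_wpM2r ?(ltW q0) // l2_sqr; apply: ler_sum => j _.
  by rewrite ger0_norm ?cnorm_ge0.
have lT0 : 0 <= lT by exact: l2_ge0.
have Dq0 : 0 <= D / q by rewrite (le_trans _ lT2) ?exprn_ge0.
(* The remainder carries [N] factors [kappa] and one factor [lT]; this bound raises the exponent to
   [N + 1]. It follows from [D <= 1] and the factorization of [q]. *)
have lTk : lT <= kappa.
  apply: ler_sqr_ge0 => //; apply: (le_trans lT2).
  rewrite ler_pdivrMr // /kappa exprVn expr2 invfM qE mulrACA mulVf ?gt_eqF //.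
  rewrite mul1r mulrC ler_pdivlMr //.
  apply: (@le_trans _ _ (1 * (1 - r))).
    by rewrite ler_wpM2r ?(ltW r1) // /D gerBl exprn_ge0.
  by rewrite mul1r lerD2l (le_trans _ r0) // oppr_le0.
pose b s j := (gz *m (Xs s *m T j)) 0 0.
exists (fun al => if mdeg al == 0%N then pz else
     \sum_(s <- words d (mdeg al).-1)
       \sum_(j | [forall i, content (j :: s) i == al i]) b s j).
split=> [al -> //|al al0|w g pw gE pwE].
  rewrite gtn_eqF // subn1; apply: le_trans (coef_bound _ _ _) _.
  rewrite ler_wpM2l ?exprn_ge0 ?sqrtC_ge0 ?ler0n //.
  rewrite mulrCA -/lT -/D -/q.
  have -> : D / (q * (1 - r) ^+ (mdeg al).-1) = kappa ^+ (mdeg al).-1 * (D / q).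
    by rewrite invfM mulrA -exprVn mulrC.
  rewrite ler_wpM2l ?exprn_ge0 //.
  (* [rnorm gz] and [lT] both have square at most [D / q], so their product is at most [D / q], with
     no square root left. *)
  apply: ler_sqr_ge0 => //; first by rewrite mulr_ge0 ?rnorm_ge0.
  by rewrite exprMn gzn [leRHS]expr2 ler_wpM2l.
have wE : w = z + (w - z) by rewrite addrC subrK.
set h := w - z in wE *.
have gY := row_shift wE gzE gE.
rewrite (transfer_shift wE gzE gE pzE pwE) tpoly_words opprD addrACA subrr add0r.
rewrite (row_iter _ N gY) [X in X + _ - _](_ : _ =
    \sum_(k < N) \sum_(s <- words d k) \sum_j
    monomial h (content (j :: s)) * b s j); last first.
  apply: eq_bigr => k _; rewrite exp_words mulmx_suml mulmx_sumr summxE.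
  apply: eq_bigr => s _; rewrite mulmx_sumr mulmx_sumr summxE.
  apply: eq_bigr => j _; rewrite !monomial_content big_cons.
  rewrite -scalemxAl -!scalemxAr scalerA [LHS]mxE.
  by rewrite (mulrC (h 0 j)).
rewrite addrAC subrr add0r.
apply: le_trans (ler_norm_mulmx _ _) _; rewrite ler_wpM2l ?rnorm_ge0 //.
apply: le_trans (iter_norm _ _ _) _.
rewrite exprSr (mulrC kappa) ler_wpM2l ?exprn_ge0 ?mulr_ge0 ?rnorm_ge0 //.
apply: le_trans (ler_cnorm_comb _ _) _.
by rewrite ler_wpM2l ?rnorm_ge0.
Qed.

End Expansion.

(** * Positivity of the kernel *)

Section Positivity.
Variables (C : numClosedFieldType) (d : nat).
Implicit Types (phi f g h : 'rV[C]_d -> C).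

Definition positive_pick_kernel phi :=
  forall k (w : 'I_k -> 'rV[C]_d), (forall i, unit_ball (w i)) ->
  forall c : 'I_k -> C,
    0 <= \sum_i \sum_j c i * (c j)^* *
           ((1 - phi (w i) * (phi (w j))^*) / (1 - cdot (w i) (w j))).

Lemma ip_sum (H : set ('rV[C]_d -> C)) ip : linear_subspace H ->
  inner_product H ip -> forall (I : Type) (s : seq I) (a : I -> C) F h,
  (forall i, H (F i)) -> H h ->
  H (fun z => \sum_(i <- s) a i * F i z) /\
  ip (fun z => \sum_(i <- s) a i * F i z) h = \sum_(i <- s) a i * ip (F i) h.
Proof.
move=> [H0 HD] [ipl _ _ _] I s a F h HF Hh; elim: s => [|i s [IH1 IH2]].
  have -> : (fun z => \sum_(i <- [::]) a i * F i z) = (fun=> 0).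
    by apply/funext => z; rewrite big_nil.
  split=> //; rewrite big_nil.
  have := ipl 1 (fun=> 0) (fun=> 0) h H0 H0 Hh.
  rewrite (_ : (fun z => _) = (fun=> 0)); last first.
    by apply/funext => z; rewrite mulr0 addr0.
  by rewrite mul1r -[LHS]addr0 => /addrI.
have -> : (fun z => \sum_(j <- i :: s) a j * F j z) =
    (fun z => a i * F i z + \sum_(j <- s) a j * F j z).
  by apply/funext => z; rewrite big_cons.
by split; [exact: HD | rewrite ipl // IH2 big_cons].
Qed.

(* With [f = sum_i (c i)^* K_{w i}] and [g = sum_i (c i)^* (phi (w i))^* K_{w i}], the
   reproducing property gives [ip (phi g) f = ip g g]; then expand
   [0 <= ip (f - phi g) (f - phi g)] and use [ip (phi g) (phi g) <= ip g g]. *)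
Lemma schur_agler_positive phi : schur_agler phi -> positive_pick_kernel phi.
Proof.
move=> [_ [H [ip [[_ _ Hlin Hip _ Hk rep] mult]]]] k w w1 c.
have [ipl ipC ip0 _] := Hip.
pose K i := arveson_kernel (w i).
have HK i : H (K i) by exact: Hk.
have Hcomb a : H (fun z => \sum_i a i * K i z).
  exact: (proj1 (ip_sum Hlin Hip _ _ HK (proj1 Hlin))).
have ip_comb a h : H h -> ip (fun z => \sum_i a i * K i z) h = \sum_i a i * (h (w i))^*.
  move=> Hh; rewrite (proj2 (ip_sum Hlin Hip _ _ HK Hh)).
  by apply: eq_bigr => i _; rewrite (rep h) // ipC.
pose f z := \sum_i (c i)^* * K i z.
pose g z := \sum_i ((c i)^* * (phi (w i))^*) * K i z.
have Hf : H f by exact: Hcomb.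
have Hg : H g by exact: Hcomb.
have [Hpg le_pg] := mult g Hg.
set pg := fun z => _ in Hpg le_pg.
have fpg : ip f pg = (ip g g)^*.
  rewrite -ipC // !ip_comb //; apply: eq_bigr => i _.
  by rewrite /pg rmorphM; exact: mulrA.
have gg0 := ip0 _ Hg.
have ggC : (ip g g)^* = ip g g by rewrite geC0_conj.
have pgpg : ip pg pg <= ip g g.
  by move: le_pg; rewrite /ip_norm ler_sqrtC ?nnegrE ?ip0.
pose D z := -1 * pg z + f z.
have HD : H D by exact: (proj2 Hlin).
have ff_gg : 0 <= ip f f - ip g g.
  have pgf : ip pg f = ip g g by rewrite (ipC f pg) // fpg !ggC.
  have realC x : 0 <= x -> x^* = x by exact: geC0_conj.
  have DD : ip D D = ip f f - ip g g - (ip g g - ip pg pg).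
    rewrite ipl // (ipC D pg) // (ipC D f) // !ipl // fpg pgf ggC !mulN1r.
    rewrite !rmorphD !rmorphN /= ggC !realC ?ip0 //; ring.
  have := ip0 _ HD; rewrite DD subr_ge0; apply: le_trans.
  by rewrite subr_ge0.
suff -> : \sum_i \sum_j c i * (c j)^* *
  ((1 - phi (w i) * (phi (w j))^*) / (1 - cdot (w i) (w j))) = ip f f - ip g g.
  by [].
have ffC : ip f f = (ip f f)^* by rewrite geC0_conj ?ip0.
rewrite ffC -ggC !ip_comb // !rmorph_sum -sumrB /=; apply: eq_bigr => i _.
rewrite !rmorphM /= !conjCK /f /g !mulr_sumr -sumrB; apply: eq_bigr => j _.
have -> : K j (w i) = 1 / (1 - cdot (w i) (w j)).
  by rewrite /K /arveson_kernel mem_set.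
by rewrite !div1r; ring.
Qed.

Lemma cdot_rnorm (z : 'rV[C]_d) : cdot z z = rnorm z ^+ 2.
Proof. by rewrite l2_sqr; apply: eq_bigr => i _; rewrite normCK. Qed.

(** The bounds involve only [r], [N] and the data at the base point, not the number of sample
    points, so they survive refinement. In the exponent [N.+2] one factor bounds the row [g i] and
    [N.+1] come from the expansion. *)
Lemma finite_taylor phi k (w : 'I_k -> 'rV[C]_d) (i0 : 'I_k) (r : C) N :
  positive_pick_kernel phi -> r < 1 -> (forall i, rnorm (w i) <= r) ->
  exists a : ('I_d -> nat) -> C,
  [/\ forall al, mdeg al = 0%N -> a al = phi (w i0),
      forall al, (0 < mdeg al)%N ->
        `|a al| <= sqrtC d%:R ^+ (mdeg al - 1) *
          ((1 - `|phi (w i0)| ^+ 2) /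
           ((1 - rnorm (w i0) ^+ 2) * (1 - rnorm (w i0)) ^+ (mdeg al - 1))) &
      forall i, `|phi (w i) - tpoly N a (w i - w i0)| <=
        (1 - r)^-1 ^+ N.+2 * rnorm (w i - w i0) ^+ N.+1].
Proof.
move=> pos r1 wr.
have r0 : 0 <= r by exact: le_trans (rnorm_ge0 _) (wr i0).
have r1' : 0 < 1 - r by rewrite subr_gt0.
have w1 i : unit_ball (w i) by rewrite unit_ballE enormE (le_lt_trans (wr i)).
have [m [g [A [B [c [e [gE pE gn contr]]]]]]] :=
  finite_realization w1 (pos k w w1).
have gn' i : rnorm (g i) ^+ 2 = (1 - `|phi (w i)| ^+ 2) / (1 - rnorm (w i) ^+ 2).
  by rewrite gn cdot_rnorm normCK.
have [a [a0 abnd arem]] :=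
  realization_taylor contr (w1 i0) N (gE i0) (pE i0) (gn' i0).
exists a; split=> // i; apply: le_trans (arem _ _ _ (gE i) (pE i)) _.
have k1 : 0 <= (1 - r)^-1 by rewrite invr_ge0 ltW.
rewrite exprMn mulrA ler_wpM2r ?exprn_ge0 ?rnorm_ge0 //.
rewrite (exprS (1 - r)^-1 N.+1); apply: ler_pM; rewrite ?rnorm_ge0 ?exprn_ge0 ?invr_ge0 ?subr_ge0 //.
- by rewrite (le_trans (wr i0)) // ltW.
- apply: ler_sqr_ge0; rewrite ?rnorm_ge0 // gn'.
  have q0 : 0 < 1 - rnorm (w i) ^+ 2.
    by rewrite subr_gt0 exprn_ilt1 ?rnorm_ge0 // (le_lt_trans (wr i)).
  rewrite ler_pdivrMr // exprVn mulrC ler_pdivlMr ?exprn_gt0 //.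
  apply: (@le_trans _ _ (1 * (1 - r) ^+ 2)).
    by rewrite ler_wpM2r ?exprn_ge0 ?(ltW r1') // gerBl exprn_ge0.
  rewrite mul1r; apply: (@le_trans _ _ (1 - r ^+ 2)).
    rewrite -subr_ge0.
    have -> : 1 - r ^+ 2 - (1 - r) ^+ 2 = r * (1 - r) *+ 2 by ring.
    by rewrite mulrn_wge0 ?mulr_ge0 // ltW.
  by rewrite lerD2l lerN2 ler_pXn2r ?nnegrE ?rnorm_ge0.
- apply: lerXn2r; rewrite ?nnegrE //.
    by rewrite invr_ge0 subr_ge0 (le_trans (wr i0)) // ltW.
  rewrite lef_pV2 ?posrE //; first by rewrite lerD2l lerN2.
  by rewrite subr_gt0 (le_lt_trans (wr i0)).
Qed.

End Positivity.

(** * Coefficients from grid values *)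

Section GridCoefficients.
Variables (C : numClosedFieldType) (d N : nat).

Local Notation midx := {ffun 'I_d -> 'I_N.+1}.

Definition vand : 'M[C]_N.+1 := Vandermonde N.+1 (\row_(k < N.+1) (k : nat)%:R).

Lemma vand_unit : vand \in unitmx.
Proof.
rewrite unitmxE det_Vandermonde unitfE; apply/prodf_neq0 => i _.
apply/prodf_neq0 => j ij; rewrite !mxE subr_eq0 eqr_nat.
by rewrite gtn_eqF.
Qed.

(** Dual basis of the powers: for polynomials of degree at most [N], [weight a] reads off the
    coefficient of [x^a] from the values at [0, ..., N]. *)
Definition weight (a k : 'I_N.+1) : C := invmx vand k a.

Lemma weight_monomial (a : 'I_N.+1) (b : nat) : (b <= N)%N ->
  \sum_k weight a k * (k : nat)%:R ^+ b = (b == a)%:R.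
Proof.
rewrite -ltnS => bN; have /matrixP/(_ (Ordinal bN) a) := mulmxV vand_unit.
rewrite !mxE -val_eqE /= => <-; apply: eq_bigr => k _.
by rewrite !mxE mulrC.
Qed.

Lemma weight_shift (t tau : C) (a : 'I_N.+1) b : (b <= N)%N ->
  \sum_k weight a k * (t + tau * (k : nat)%:R) ^+ b =
  t ^+ (b - a) *+ 'C(b, a) * tau ^+ a.
Proof.
move=> bN; under eq_bigr do rewrite exprDn mulr_sumr.
rewrite exchange_big /=.
transitivity (\sum_(i < b.+1) (i == a :> nat)%:R *
    (t ^+ (b - i) *+ 'C(b, i) * tau ^+ i)).
  apply: eq_bigr => i _.
  rewrite -(weight_monomial _ (b := i)); last first.
    by rewrite (leq_trans _ bN) // -ltnS.
  rewrite mulr_suml; apply: eq_bigr => k _.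
  by rewrite exprMn; ring.
case: (leqP a b) => ab.
  rewrite (bigD1 (Ordinal (ab : (a < b.+1)%N))) //= eqxx mul1r big1 ?addr0 //.
  by move=> i; rewrite -val_eqE /= => /negbTE ->; rewrite mul0r.
rewrite bin_small // mulr0n mul0r big1 // => i _.
by rewrite ltn_eqF ?mul0r // (leq_trans (ltn_ord i)).
Qed.

Definition gridpt (tau : C) (k : midx) : 'rV[C]_d :=
  \row_i (tau * (k i : nat)%:R).

(* Tensor product of inverse Vandermonde functionals: on a polynomial of degree at
   most [N] it returns [tau ^ |a|] times the coefficient of index [a]. *)
Definition extract (a : midx) (tau : C) (f : 'rV[C]_d -> C) : C :=
  \sum_(k : midx) (\prod_i weight (a i) (k i)) * f (gridpt tau k).

(** Summing over [a] as well gives one constant valid for all the functionals [extract a]. *)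
Definition wnorm : C := \sum_(a : midx) \sum_(k : midx) `|\prod_i weight (a i) (k i)|.

Lemma wnorm_ge0 : 0 <= wnorm.
Proof. by do 2!(apply: sumr_ge0 => ? _). Qed.

Lemma extract_bound a tau f M :
  (forall k, `|f (gridpt tau k)| <= M) -> `|extract a tau f| <= wnorm * M.
Proof.
move=> fM; apply: le_trans (ler_norm_sum _ _ _) _.
have M0 : 0 <= M by exact: le_trans (fM a).
rewrite /wnorm [in leRHS](bigD1 a) //= mulrDl.
rewrite ler_wpDr //.
  by rewrite mulr_ge0 // sumr_ge0 // => ? _; rewrite sumr_ge0.
rewrite mulr_suml; apply: ler_sum => k _.
by rewrite normrM ler_wpM2l.
Qed.

Lemma extractB a tau f g :
  extract a tau (fun h => f h - g h) = extract a tau f - extract a tau g.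
Proof. by rewrite /extract -sumrB; apply: eq_bigr => k _; rewrite mulrBr. Qed.

(** Coefficient of [h^a] in [(h0 + h)^b]; the binomial factor is 0 where the subtraction [b i - a i]
    truncates. *)
Definition shift_coef (h0 : 'rV[C]_d) (a b : 'I_d -> nat) : C :=
  \prod_i (h0 0 i ^+ (b i - a i) *+ 'C(b i, a i)).

Lemma extract_tpoly (a : midx) tau (c : ('I_d -> nat) -> C) (h0 : 'rV[C]_d) :
  extract a tau (fun h => tpoly N c (h0 + h)) =
  tau ^+ mdeg (fun i => a i) *
  \sum_(b : midx | (mdeg (fun i => b i) <= N)%N)
    c (fun i => b i) * shift_coef h0 (fun i => a i) (fun i => b i).
Proof.
rewrite /extract /tpoly; under eq_bigr do rewrite mulr_sumr.
rewrite exchange_big mulr_sumr /=; apply: eq_bigr => b bN.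
transitivity (c (fun i => b i) * \prod_i \sum_(k < N.+1)
    weight (a i) k * (h0 0 i + tau * (k : nat)%:R) ^+ b i).
  rewrite bigA_distr_bigA mulr_sumr; apply: eq_bigr => k _.
  rewrite mulrCA -big_split /=; congr (_ * _); apply: eq_bigr => i _.
  by rewrite !mxE.
rewrite mulrCA /shift_coef /mdeg; congr (_ * _).
rewrite -prodrXr -big_split; apply: eq_bigr => i _ /=.
rewrite weight_shift; last by rewrite -ltnS ltn_ord.
by rewrite mulrC.
Qed.

Lemma extract_tpoly0 (a : midx) tau (c : ('I_d -> nat) -> C) :
  (mdeg (fun i => a i) <= N)%N ->
  extract a tau (tpoly N c) = tau ^+ mdeg (fun i => a i) * c (fun i => a i).
Proof.
move=> aN; have := extract_tpoly a tau c 0.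
under [X in extract _ _ X]eq_fun do rewrite add0r.
move=> ->; congr (_ * _); rewrite (bigD1 a) //= big1 ?addr0.
  rewrite /shift_coef big1 ?mulr1 // => i _.
  by rewrite subnn binn expr0.
move=> b /andP[_ ba]; rewrite /shift_coef.
have [i ia] : exists i, b i != a i.
  apply/existsP; rewrite -negb_forall; apply: contra ba => /forallP ba.
  by apply/eqP/ffunP => i; apply/eqP/ba.
rewrite (bigD1 i) //= mxE; case: (ltngtP (a i) (b i)) => ab.
- by rewrite expr0n subn_eq0 leqNgt ab mul0rn mul0r mulr0.
- by rewrite bin_small // mulr0n mul0r mulr0.
- by case/eqP: ia; apply/val_inj.
Qed.

Lemma rnorm_gridpt tau k : rnorm (gridpt tau k) <= `|tau| * rnorm (const_mx N%:R : 'rV[C]_d).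
Proof.
rewrite /rnorm -l2Z; apply: ler_l2 => i; rewrite !mxE !normrM.
by rewrite ler_wpM2l // !normr_nat ler_nat -ltnS.
Qed.

End GridCoefficients.

(** * From finite grids to the coefficients of the power series *)

Section Uniform.
Variables (C : numClosedFieldType) (d : nat).
Implicit Types (phi : 'rV[C]_d -> C) (z h w : 'rV[C]_d) (c : ('I_d -> nat) -> C).

(** The order of [C] is partial, so [x - y] is first seen to be real, being below the real number
    [K * e0]. *)
Lemma le_of_small (x y K e0 : C) : 0 < e0 -> 0 <= K ->
  (forall e, 0 < e -> e <= e0 -> x <= y + K * e) -> x <= y.
Proof.
move=> e00 K0 le; rewrite -subr_le0; set D := x - y.
have leD e : 0 < e -> e <= e0 -> D <= K * e by move=> ? ?; rewrite lerBlDl le.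
have Dr : D \is Num.real.
  by rewrite -(ger_real (leD _ e00 (lexx _))) ger0_real // mulr_ge0 // ltW.
rewrite real_leNgt ?real0 //; apply/negP => D0.
have P0 : 0 < D + e0 * (K + 1).
  by rewrite addr_gt0 // mulr_gt0 // ltr_wpDl.
(* This value is at most [e0], and [K] times it is smaller than [D], a contradiction. *)
have := leD (e0 * D / (D + e0 * (K + 1))).
rewrite divr_gt0 ?mulr_gt0 // ler_pdivrMr // => /(_ isT).
rewrite ler_wpM2l ?(ltW e00) //; last first.
  by rewrite lerDl mulr_ge0 ?addr_ge0 // ltW.
move=> /(_ isT); rewrite mulrA ler_pdivlMr // mulrCA mulrC.
rewrite -[X in X <= _]mulrC -subr_le0.
have -> : D * (D + e0 * (K + 1)) - e0 * (K * D) = D * (D + e0) by ring.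
by rewrite lt_geF // mulr_gt0 // addr_gt0.
Qed.

Lemma pos_lower_bound2 (a b : C) : 0 < a -> 0 < b ->
  exists e, [/\ 0 < e, e <= a & e <= b].
Proof.
move=> a0 b0; have ab0 : 0 < a + b by rewrite addr_gt0.
exists (a * b / (a + b)); split; first by rewrite divr_gt0 ?mulr_gt0.
  by rewrite ler_pdivrMr // ler_wpM2l ?(ltW a0) // lerDr ltW.
by rewrite ler_pdivrMr // mulrC ler_wpM2l ?(ltW b0) // lerDl ltW.
Qed.

Lemma rnormD (x y : 'rV[C]_d) : rnorm (x + y) <= rnorm x + rnorm y.
Proof. by apply: le_trans (ler_l2D _ _); apply: ler_l2 => i; rewrite mxE. Qed.

Lemma rnorm_row0 : rnorm (0 : 'rV[C]_d) = 0.
Proof. by rewrite /rnorm /l2 big1 ?sqrtC0 // => i _; rewrite mxE normr0 expr0n. Qed.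

Lemma tpolyB N (a b : ('I_d -> nat) -> C) h :
  tpoly N (fun al => a al - b al) h = tpoly N a h - tpoly N b h.
Proof. by rewrite /tpoly -sumrB; apply: eq_bigr => k _; rewrite mulrBl. Qed.

(* [tpoly] is truncated by total degree, hence the error of order [N + 1]. *)
Definition taylor_at phi z c := forall N, exists M s : C,
  [/\ 0 <= M, 0 < s & forall h, rnorm h <= s ->
    `|phi (z + h) - tpoly N c h| <= M * rnorm h ^+ N.+1].

Lemma finite_taylor_fin (I : finType) phi (w : I -> 'rV[C]_d) (i0 : I) (r : C) N :
  positive_pick_kernel phi -> r < 1 -> (forall i, rnorm (w i) <= r) ->
  exists a : ('I_d -> nat) -> C,
  [/\ forall al, mdeg al = 0%N -> a al = phi (w i0),
      forall al, (0 < mdeg al)%N ->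
        `|a al| <= sqrtC d%:R ^+ (mdeg al - 1) *
          ((1 - `|phi (w i0)| ^+ 2) /
           ((1 - rnorm (w i0) ^+ 2) * (1 - rnorm (w i0)) ^+ (mdeg al - 1))) &
      forall i, `|phi (w i) - tpoly N a (w i - w i0)| <=
        (1 - r)^-1 ^+ N.+2 * rnorm (w i - w i0) ^+ N.+1].
Proof.
move=> pos r1 wr.
have [|a [a0 ab ar]] := @finite_taylor _ _ phi _ (fun i => w (enum_val i))
  (enum_rank i0) r N pos r1; first by move=> i; exact: wr.
rewrite enum_rankK in a0 ab ar; exists a; split=> // i.
by have := ar (enum_rank i); rewrite enum_rankK.
Qed.

(** The finite Taylor expansion is taken on [z], [z + h] and a grid of mesh [e] around [z]. On the
    grid both polynomials are within [O(e^(N+1))] of [phi], so extraction gives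
    [e^|k| |c_k - a_k| = O(e^(N+1))], hence [O(e)] as [|k| <= N]. The family [a] depends on [e], but
    [K] does not. *)
Lemma coef_compare phi z c h (r rr : C) N :
  positive_pick_kernel phi -> taylor_at phi z c -> r < rr -> rr < 1 ->
  rnorm z <= r -> rnorm (z + h) <= r ->
  exists K e0 : C, [/\ 0 <= K, 0 < e0 & forall e, 0 < e -> e <= e0 ->
    exists a : ('I_d -> nat) -> C,
    [/\ forall al, (0 < mdeg al)%N ->
        `|a al| <= sqrtC d%:R ^+ (mdeg al - 1) *
          ((1 - `|phi z| ^+ 2) /
           ((1 - rnorm z ^+ 2) * (1 - rnorm z) ^+ (mdeg al - 1))),
      `|phi (z + h) - tpoly N a h| <= (1 - rr)^-1 ^+ N.+2 * rnorm h ^+ N.+1 &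
      forall k : {ffun 'I_d -> 'I_N.+1}, (mdeg (fun i => k i) <= N)%N ->
        `|c (fun i => k i) - a (fun i => k i)| <= K * e]].
Proof.
move=> pos tay rrr rr1 zr zhr.
have [M [s [M0 s0 rem]]] := tay N.
pose G := rnorm (const_mx N%:R : 'rV[C]_d).
have G0 : 0 <= G by exact: rnorm_ge0.
have G1 : 0 < G + 1 by rewrite ltr_wpDl.
(* The mesh keeps the grid within the radius [s] where the estimate for [c] holds, and within the
   ball of radius [rr]. Using [G + 1] avoids a division by zero. *)
have [e1 [e10 e1s e1r]] : exists e, [/\ 0 < e, e <= s / (G + 1) & e <= (rr - r) / (G + 1)].
  by apply: pos_lower_bound2; rewrite divr_gt0 ?subr_gt0.
have [e0 [e00 e0e1 e01]] := pos_lower_bound2 e10 (@ltr01 C).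
pose M' := (1 - rr)^-1 ^+ N.+2.
have M'0 : 0 <= M' by rewrite exprn_ge0 // invr_ge0 subr_ge0 ltW.
have K0 : 0 <= wnorm C d N * ((M + M') * G ^+ N.+1).
  apply: mulr_ge0; first exact: wnorm_ge0.
  by apply: mulr_ge0; [exact: addr_ge0 | exact: exprn_ge0].
exists (wnorm C d N * ((M + M') * G ^+ N.+1)), e0; split=> //.
move=> e e_gt0 ee0.
have eG x : e1 <= x / (G + 1) -> e * G <= x.
  move=> e1x; apply: (@le_trans _ _ (e * (G + 1))).
    by rewrite ler_wpM2l ?(ltW e_gt0) // lerDl.
  rewrite -ler_pdivlMr //; exact: le_trans (le_trans ee0 e0e1) e1x.
have grid (k : {ffun 'I_d -> 'I_N.+1}) : rnorm (gridpt e k) <= e * G.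
  by rewrite (le_trans (rnorm_gridpt _ _)) // (gtr0_norm e_gt0).
pose w (o : option (option {ffun 'I_d -> 'I_N.+1})) :=
  match o with None => z | Some None => z + h | Some (Some k) => z + gridpt e k end.
have wr o : rnorm (w o) <= rr.
  case: o => [[k|]|] /=; rewrite ?(le_trans zr) ?(le_trans zhr) ?(ltW rrr) //.
  apply: le_trans (rnormD _ _) _; rewrite -lerBrDl.
  apply: le_trans (grid k) _; apply: le_trans (eG _ e1r) _.
  by rewrite lerD2l lerN2.
have [a [a0 ab ar]] := finite_taylor_fin None N pos rr1 wr.
exists a; split=> // [|k kN].
  by have := ar (Some None); rewrite /= addrAC subrr add0r.
have [kap capE] : exists m, (N.+1 = mdeg (fun i => k i) + m.+1)%N.
  by exists (N - mdeg (fun i => k i))%N; rewrite addnS subnKC.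
have : `|extract k e (fun g => tpoly N c g - tpoly N a g)| <=
    wnorm C d N * ((M + M') * (e * G) ^+ N.+1).
  apply: extract_bound => k'.
  have -> : tpoly N c (gridpt e k') - tpoly N a (gridpt e k') =
     (phi (z + gridpt e k') - tpoly N a (gridpt e k'))
     - (phi (z + gridpt e k') - tpoly N c (gridpt e k')) by ring.
  apply: le_trans (ler_normB _ _) _; rewrite addrC mulrDl; apply: lerD.
    apply: le_trans (rem _ _) _; first by rewrite (le_trans (grid _)) // eG.
    by rewrite ler_wpM2l // lerXn2r ?nnegrE ?rnorm_ge0 ?mulr_ge0 // ltW.
  have := ar (Some (Some k')); rewrite /= addrAC subrr add0r => /le_trans; apply.
  by rewrite ler_wpM2l // lerXn2r ?nnegrE ?rnorm_ge0 ?mulr_ge0 // ltW.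
rewrite extractB !extract_tpoly0 // -mulrBr normrM normrX (gtr0_norm e_gt0).
have eN : e ^+ N.+1 = e ^+ mdeg (fun i => k i) * (e * e ^+ kap).
  by rewrite -exprS -exprD -capE.
rewrite exprMn eN.
set D := `|_ - _|; set m := mdeg _.
have -> : wnorm C d N * ((M + M') * (e ^+ m * (e * e ^+ kap) * G ^+ N.+1)) =
   e ^+ m * ((wnorm C d N * ((M + M') * G ^+ N.+1) * e) * e ^+ kap) by ring.
rewrite ler_pM2l ?exprn_gt0 // => /le_trans; apply.
rewrite ler_piMr //; last first.
  by rewrite exprn_ile1 ?(ltW e_gt0) // (le_trans ee0).
by rewrite mulr_ge0 // ltW.
Qed.

End Uniform.

(** * Differentiating the Taylor coefficients *)

Section CoefficientDerivative.
Variables (C : numClosedFieldType) (d : nat).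
Implicit Types (phi : 'rV[C]_d -> C) (z h w : 'rV[C]_d) (al : 'I_d -> nat).

Lemma exists_between (x y : C) : x < y -> exists2 u, x < u & u < y.
Proof. by move=> xy; exists ((x + y) / 2%:R); rewrite midf_lt. Qed.

Lemma midx_of_nat N al : (mdeg al <= N)%N ->
  exists k : {ffun 'I_d -> 'I_N.+1}, (fun i => k i : nat) = al.
Proof.
move=> alN; have lt i : (al i < N.+1)%N.
  by rewrite ltnS (leq_trans _ alN) // /mdeg (bigD1 i) //= leq_addr.
exists [ffun i => Ordinal (lt i)].
by apply/funext => i; rewrite ffunE.
Qed.

(** Take [h = 0] in [coef_compare] and let the mesh tend to 0: [c al] is a limit of coefficients
    that satisfy the bound. *)
Lemma taylor_coef_bound phi z c al : positive_pick_kernel phi ->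
  taylor_at phi z c -> unit_ball z -> (0 < mdeg al)%N ->
  `|c al| <= sqrtC d%:R ^+ (mdeg al - 1) * ((1 - `|phi z| ^+ 2) /
    ((1 - rnorm z ^+ 2) * (1 - rnorm z) ^+ (mdeg al - 1))).
Proof.
move=> pos tay z1 al0; have [k kE] := midx_of_nat (leqnn (mdeg al)).
rewrite unit_ballE enormE in z1; have [rr zrr rr1] := exists_between z1.
have z0 : rnorm (z + 0) <= rnorm z by rewrite addr0.
have [K [e0 [K0 e00 cmp]]] :=
  coef_compare (mdeg al) pos tay zrr rr1 (lexx _) z0.
apply: (le_of_small e00 K0) => e e_gt0 ee0.
have [a [ab _ ca]] := cmp e e_gt0 ee0.
have := ca k; rewrite kE => /(_ (leqnn _)) ca'.
rewrite -[c al](subrK (a al)) (le_trans (ler_normD _ _)) // addrC.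
exact: lerD (ab _ al0) ca'.
Qed.

(** In [taylor_at] the constants [M] and [s] may vary with the centre; here, in the limit of
    vanishing mesh, the constant depends on [rr] and [N] only. This makes expansions at two centres
    comparable. *)
Lemma taylor_uniform phi z c h (r rr : C) N : positive_pick_kernel phi ->
  taylor_at phi z c -> r < rr -> rr < 1 -> rnorm z <= r -> rnorm (z + h) <= r ->
  `|phi (z + h) - tpoly N c h| <= (1 - rr)^-1 ^+ N.+2 * rnorm h ^+ N.+1.
Proof.
move=> pos tay rrr rr1 zr zhr.
have [K [e0 [K0 e00 cmp]]] := coef_compare N pos tay rrr rr1 zr zhr.
pose S := \sum_(k : {ffun 'I_d -> 'I_N.+1} | (mdeg (fun i => k i) <= N)%N)
  `|monomial h (fun i => k i)|.
have S0 : 0 <= S by rewrite sumr_ge0.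
apply: (le_of_small e00 (mulr_ge0 K0 S0)) => e e_gt0 ee0.
have [a [_ ah ca]] := cmp e e_gt0 ee0.
have -> : phi (z + h) - tpoly N c h =
  (phi (z + h) - tpoly N a h) - tpoly N (fun al => c al - a al) h.
  by rewrite tpolyB; ring.
apply: le_trans (ler_normB _ _) _; apply: lerD => //.
apply: le_trans (ler_norm_sum _ _ _) _.
rewrite mulrAC mulr_sumr; apply: ler_sum => k kN.
by rewrite normrM ler_wpM2r // ca.
Qed.

Definition incr al (j : 'I_d) : 'I_d -> nat := fun i => (al i + (i == j))%N.

Lemma mdeg_incr al j : mdeg (incr al j) = (mdeg al).+1.
Proof.
rewrite /mdeg /incr big_split /= -[RHS]addn1; congr (_ + _)%N.
by rewrite (bigD1 j) //= eqxx big1 ?addn0 // => i /negbTE ->.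
Qed.

Lemma rnorm_scale_delta (t : C) j : rnorm (t *: delta_mx 0 j : 'rV[C]_d) = `|t|.
Proof.
apply/eqP; rewrite -(eqrXn2 (n := 2)) ?rnorm_ge0 // l2_sqr (bigD1 j) //=.
rewrite !mxE !eqxx mulr1 big1 ?addr0 // => i ij.
by rewrite !mxE (negbTE ij) andbF mulr0 normr0 expr0n.
Qed.

Lemma shift_coef_id (t : C) j al : shift_coef (t *: delta_mx 0 j) al al = 1.
Proof. by rewrite /shift_coef big1 // => i _; rewrite subnn binn expr0. Qed.

Lemma shift_coef_incr (t : C) j al :
  shift_coef (t *: delta_mx 0 j) al (incr al j) = t *+ (al j).+1.
Proof.
rewrite /shift_coef (bigD1 j) //= /incr eqxx addn1 subSnn binSn !mxE !eqxx mulr1.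
rewrite big1 ?mulr1 // => i /negbTE ->.
by rewrite addn0 subnn binn expr0.
Qed.

(* If [be] differs from [al] off [j], or [be j < al j], the left-hand side is [0]. *)
Lemma shift_coef_small (t : C) j al be : be <> al -> be <> incr al j -> `|t| <= 1 ->
  `|shift_coef (t *: delta_mx 0 j) al be| <= 'C(be j, al j)%:R * `|t| ^+ 2.
Proof.
move=> ne ne' t1; rewrite /shift_coef.
have rhs0 : 0 <= 'C(be j, al j)%:R * `|t| ^+ 2 by rewrite mulr_ge0 ?exprn_ge0.
have [/existsP[i /andP[ij ab]]|] := boolP [exists i, (i != j) && (al i != be i)].
  rewrite (bigD1 i) //= !mxE (negbTE ij) andbF mulr0 expr0n subn_eq0.
  case: (ltngtP (al i) (be i)) ab => // ab _.
    by rewrite mul0rn mul0r normr0.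
  by rewrite bin_small // mulr0n mul0r normr0.
rewrite negb_exists => /forallP eqi.
have {}eqi i : i != j -> be i = al i.
  by move=> ij; have := eqi i; rewrite ij /= negbK => /eqP.
rewrite (bigD1 j) //= big1 ?mulr1; last first.
  by move=> i /eqi ->; rewrite subnn binn expr0.
rewrite !mxE !eqxx mulr1.
case: (ltnP (be j) (al j)) => [ab|]; first by rewrite bin_small // mulr0n normr0.
rewrite leq_eqVlt => /orP[/eqP ab|].
  by case: ne; apply/funext => i; case: (eqVneq i j) => [->|/eqi].
rewrite leq_eqVlt => /orP[/eqP ab|ab].
  case: ne'; apply/funext => i; rewrite /incr.
  by case: (eqVneq i j) => [->|/eqi ->]; rewrite ?addn1 ?addn0.
have [l ->] : exists l, (be j - al j = 2 + l)%N.
  by exists (be j - al j - 2)%N; rewrite subnKC // ltn_subRL addn1.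
rewrite normrMn normrX -[leLHS]mulr_natl ler_wpM2l // exprD ler_piMr ?exprn_ge0 //.
by rewrite exprn_ile1.
Qed.

End CoefficientDerivative.

Section CoefficientExpansion.
Variables (C : numClosedFieldType) (d : nat).

(** The expansions at [w] and [w + t e_j], to order [N = |al| + 1], are compared on a grid of mesh
    [|t|] around the second centre. They differ there by [O(|t|^(N+1))]; extracting the coefficient
    [al] divides this by [|t|^|al|], which leaves [|t|^2]. *)
Lemma taylor_coef_shift (phi : 'rV[C]_d -> C) (a : 'rV[C]_d -> ('I_d -> nat) -> C) :
  positive_pick_kernel phi ->
  (forall w, unit_ball w -> taylor_at phi w (a w)) ->
  forall (w : 'rV[C]_d) al j, unit_ball w ->
  exists K e0 : C, [/\ 0 <= K, 0 < e0 & forall t, `|t| <= e0 ->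
    `|a (w + t *: delta_mx 0 j) al - a w al - t *+ (al j).+1 * a w (incr al j)|
      <= K * `|t| ^+ 2].
Proof.
move=> pos tay w al j w1; pose N := (mdeg al).+1.
have w1' : rnorm w < 1 by rewrite -enormE -unit_ballE.
have [r wr r1] := exists_between w1'.
have [rr rrr rr1] := exists_between r1.
pose G := rnorm (const_mx N%:R : 'rV[C]_d).
have G0 : 0 <= G by exact: rnorm_ge0.
have G1 : 0 < G + 1 by rewrite ltr_wpDl.
have r0 : 0 < (r - rnorm w) / (G + 1) by rewrite divr_gt0 ?subr_gt0.
have [e0 [e00 e0r e01]] := pos_lower_bound2 r0 (@ltr01 C).
pose M := (1 - rr)^-1 ^+ N.+2.
have M0 : 0 <= M by rewrite exprn_ge0 // invr_ge0 subr_ge0 ltW.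
pose K1 := wnorm C d N * ((M + M) * (G + 1) ^+ N.+1).
have K10 : 0 <= K1.
  apply: mulr_ge0; first exact: wnorm_ge0.
  by apply: mulr_ge0; [exact: addr_ge0 | rewrite exprn_ge0 // ltW].
pose K2 := \sum_(b : {ffun 'I_d -> 'I_N.+1}) `|a w (fun i => b i)| * 'C(b j, al j)%:R.
have K20 : 0 <= K2 by apply: sumr_ge0 => b _; rewrite mulr_ge0.
exists (K1 + K2), e0; split=> //; first exact: addr_ge0.
move=> t te0; have t1 : `|t| <= 1 by exact: le_trans te0 e01.
have tG : `|t| * (G + 1) <= r - rnorm w.
  by rewrite -ler_pdivlMr // (le_trans te0).
have [->|t0] := eqVneq t 0.
  by rewrite scale0r addr0 subrr mul0rn mul0r subrr normr0 mulr_ge0 // addr_ge0.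
set dl := t *: delta_mx 0 j; pose tau := `|t|.
have tau0 : 0 < tau by rewrite normr_gt0.
have dl_norm : rnorm dl = tau by rewrite /dl rnorm_scale_delta.
have grid (k : {ffun 'I_d -> 'I_N.+1}) : rnorm (gridpt tau k) <= tau * G.
  by rewrite (le_trans (rnorm_gridpt _ _)) // (gtr0_norm tau0).
have shift_le (k : {ffun 'I_d -> 'I_N.+1}) : rnorm (dl + gridpt tau k) <= tau * (G + 1).
  rewrite (le_trans (rnormD _ _)) // dl_norm mulrDr mulr1 addrC.
  by rewrite lerD2r.
have wdl : rnorm (w + dl) <= r.
  rewrite (le_trans (rnormD _ _)) // dl_norm -lerBrDl (le_trans _ tG) //.
  by rewrite ler_peMr ?(ltW tau0) // lerDr.
have wdlk (k : {ffun 'I_d -> 'I_N.+1}) : rnorm (w + (dl + gridpt tau k)) <= r.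
  rewrite (le_trans (rnormD _ _)) // -lerBrDl (le_trans _ tG) //.
have wdl1 : unit_ball (w + dl) by rewrite unit_ballE enormE (le_lt_trans wdl).
have alN : (mdeg al <= N)%N by exact: leqnSn.
have [k kE] := midx_of_nat alN.
have [k' k'E] : exists k : {ffun 'I_d -> 'I_N.+1}, (fun i => k i : nat) = incr al j.
  by apply: midx_of_nat; rewrite mdeg_incr.
have : `|extract k tau (fun g => tpoly N (a (w + dl)) g - tpoly N (a w) (dl + g))| <=
    wnorm C d N * ((M + M) * (tau * (G + 1)) ^+ N.+1).
  apply: extract_bound => g; set gp := gridpt tau g.
  have -> : tpoly N (a (w + dl)) gp - tpoly N (a w) (dl + gp) =
     (phi (w + (dl + gp)) - tpoly N (a w) (dl + gp))
     - (phi (w + dl + gp) - tpoly N (a (w + dl)) gp) by rewrite addrA; ring.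
  apply: le_trans (ler_normB _ _) _; rewrite mulrDl; apply: lerD.
    apply: le_trans (taylor_uniform N pos (tay _ w1) rrr rr1 (ltW wr) (wdlk g)) _.
    by rewrite ler_wpM2l // lerXn2r ?nnegrE ?rnorm_ge0 ?mulr_ge0 ?shift_le // ltW.
  apply: le_trans (taylor_uniform N pos (tay _ wdl1) rrr rr1 wdl _) _.
    by rewrite -addrA wdlk.
  rewrite ler_wpM2l // lerXn2r ?nnegrE ?rnorm_ge0 ?mulr_ge0 ?(ltW tau0) ?(ltW G1) //.
  by rewrite (le_trans (grid g)) // ler_wpM2l ?(ltW tau0) // lerDl.
rewrite extractB extract_tpoly0 kE // extract_tpoly kE -mulrBr normrM normrX.
rewrite (gtr0_norm tau0) exprMn.
have -> : tau ^+ N.+1 = tau ^+ mdeg al * tau ^+ 2 by rewrite -exprD addn2.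
set S := \sum_(b | _) _.
have -> : wnorm C d N * ((M + M) * (tau ^+ mdeg al * tau ^+ 2 * (G + 1) ^+ N.+1)) =
   tau ^+ mdeg al * (K1 * tau ^+ 2) by rewrite /K1; ring.
rewrite ler_pM2l ?exprn_gt0 // => near_S.
have kk' : k' != k.
  apply/eqP => /(congr1 (fun b : {ffun 'I_d -> 'I_N.+1} => mdeg (fun i => b i))).
  by rewrite k'E kE mdeg_incr => /eqP; rewrite gtn_eqF.
(* In the re-expansion at the new centre, [al] and [incr al j] give the terms of order 0 and 1 in
   [t]; all the others are quadratic and go into [E]. *)
rewrite [S](bigD1 k) ?kE //= (bigD1 k') /= ?k'E ?mdeg_incr ?leqnn // in near_S.
rewrite shift_coef_id shift_coef_incr mulr1 in near_S.
set E := \sum_(b | _) _ in near_S.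
have EK : `|E| <= K2 * tau ^+ 2.
  apply: le_trans (ler_norm_sum _ _ _) _.
  rewrite /K2 mulr_suml big_mkcond; apply: ler_sum => b _.
  case: ifP => [/andP[/andP[_ bk] bk']|_]; last first.
    by rewrite !mulr_ge0 ?exprn_ge0 // ltW.
  rewrite normrM -mulrA ler_wpM2l // shift_coef_small //.
    move=> bal; case/eqP: bk; apply/ffunP => i; apply/val_inj.
    by move/(congr1 (fun f => f i)): (etrans bal (esym kE)).
  move=> bal; case/eqP: bk'; apply/ffunP => i; apply/val_inj.
  by move/(congr1 (fun f => f i)): (etrans bal (esym k'E)).
rewrite -/tau mulrDl.
have -> : a (w + dl) al - a w al - t *+ (al j).+1 * a w (incr al j) =
  (a (w + dl) al - (a w al + (a w (incr al j) * (t *+ (al j).+1) + E))) + E.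
  by rewrite mulrC; ring.
by apply: le_trans (ler_normD _ _) _; apply: lerD.
Qed.

End CoefficientExpansion.

(** * Mixed partial derivatives as multiples of Taylor coefficients *)

Section MixedPartial.
Variables (C : numClosedFieldType) (d : nat).
Local Open Scope classical_set_scope.

Lemma derive_of_quadratic_error (f : 'rV[C]_d -> C) (v w : 'rV[C]_d) (l K e0 : C) :
  0 <= K -> 0 < e0 ->
  (forall t, `|t| <= e0 -> `|f (w + t *: v) - f w - t * l| <= K * `|t| ^+ 2) ->
  'D_v f w = l.
Proof.
move=> K0 e00 fl; apply/cvg_lim => //.
apply/cvgrPdist_le => e e_gt0.
have [u [u0 ue0 ue]] := pos_lower_bound2 e00 (divr_gt0 e_gt0 (ltr_wpDl K0 (@ltr01 C))).
near=> t.
have t0 : t != 0 by near: t; exact: nbhs_dnbhs_neq.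
have tu : `|t| <= u.
  near: t; apply: nbhs_dnbhs; apply/nbhs_ballP; exists u => // y /=.
  by rewrite /ball /= sub0r normrN => /ltW.
have nt0 : 0 < `|t| by rewrite normr_gt0.
rewrite distrC /= /shift /= addrC.
have -> : - l + t^-1 *: (f (t *: v + w) - f w) = t^-1 * (f (w + t *: v) - f w - t * l).
  by rewrite (addrC w) mulrBr mulKf // [LHS]addrC.
rewrite normrM normfV mulrC ler_pdivrMr //.
apply: le_trans (fl t (le_trans tu ue0)) _.
rewrite expr2 mulrA ler_wpM2r //.
apply: (@le_trans _ _ ((K + 1) * `|t|)); first by rewrite ler_wpM2r // lerDl.
by rewrite mulrC -ler_pdivlMr ?(le_trans tu) // ltr_wpDl.
Unshelve. all: by end_near. Qed.

Variables (phi : 'rV[C]_d -> C) (a : 'rV[C]_d -> ('I_d -> nat) -> C).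
Hypothesis pos : positive_pick_kernel phi.
Hypothesis tay : forall w, unit_ball w -> taylor_at phi w (a w).

Lemma partial_coef (g : 'rV[C]_d -> C) k al j :
  (forall w, unit_ball w -> g w = k * a w al) ->
  forall w, unit_ball w -> partial j g w = k * ((al j).+1%:R * a w (incr al j)).
Proof.
move=> gE w w1; have [K [e0 [K0 e00 quad]]] := taylor_coef_shift pos tay al j w1.
(* The formula for [g] holds on the ball only, so the increments must be small enough not to leave
   it. *)
have w1' : 0 < 1 - rnorm w by rewrite subr_gt0 -enormE -unit_ballE.
have [u u0 u1] := exists_between w1'.
have [e [e_gt0 ee0 eu]] := pos_lower_bound2 e00 u0.
apply: (@derive_of_quadratic_error _ _ _ _ (`|k| * K) e) => //.
  by rewrite mulr_ge0.
move=> t te; have wt : unit_ball (w + t *: delta_mx 0 j).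
  rewrite unit_ballE enormE (le_lt_trans (rnormD _ _)) // -ltrBrDl.
  by rewrite rnorm_scale_delta (le_lt_trans te) // (le_lt_trans eu).
rewrite !gE // -mulrA -(mulrBr k).
have -> : k * (a (w + t *: delta_mx 0 j) al - a w al) -
    t * (k * ((al j).+1%:R * a w (incr al j))) =
  k * (a (w + t *: delta_mx 0 j) al - a w al - t *+ (al j).+1 * a w (incr al j)).
  by rewrite -[t *+ _]mulr_natr; ring.
by rewrite normrM ler_wpM2l // quad // (le_trans te).
Qed.

Definition incrn al (j : 'I_d) m : 'I_d -> nat := fun i => (al i + (i == j) * m)%N.

(** Because the exponent of [j] starts at 0, the successive factors are [1, ..., m], with product
    [m!]. *)
Lemma iter_partial_coef (g : 'rV[C]_d -> C) k al j m : al j = 0%N ->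
  (forall w, unit_ball w -> g w = k * a w al) ->
  forall w, unit_ball w -> iter m (partial j) g w = k * m`!%:R * a w (incrn al j m).
Proof.
move=> al0 gE; elim: m => [|m IH] w w1.
  rewrite /= gE // fact0 mulr1; congr (_ * a w _).
  by apply/funext => i; rewrite /incrn muln0 addn0.
rewrite iterS (partial_coef j IH w1) factS natrM.
have -> : (incrn al j m j).+1 = m.+1 by rewrite /incrn al0 eqxx mul1n.
have -> : incr (incrn al j m) j = incrn al j m.+1.
  by apply/funext => i; rewrite /incr /incrn mulnS -addnA (addnC (_ * _)%N).
by rewrite mulrA (mulrC m.+1%:R) mulrA.
Qed.

(** Since [s] has no repetition, each direction is still at exponent 0 when its turn comes, so its
    derivatives contribute a full factorial. *)
Lemma foldl_partial_coef (n : 'I_d -> nat) (s : seq 'I_d) (g : 'rV[C]_d -> C) k al :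
  uniq s -> (forall j, j \in s -> al j = 0%N) ->
  (forall w, unit_ball w -> g w = k * a w al) ->
  forall w, unit_ball w ->
  foldl (fun g j => iter (n j) (partial j) g) g s w =
  k * (\prod_(j <- s) (n j)`!)%:R * a w (fun i => (al i + (i \in s) * n i)%N).
Proof.
elim: s g k al => [|j s IH] g k al /=.
  move=> _ _ gE w w1; rewrite gE // big_nil mulr1; congr (_ * a w _).
  by apply/funext => i; rewrite addn0.
move=> /andP[js us] al0 gE w w1.
have alj : al j = 0%N by rewrite al0 ?mem_head.
rewrite (IH _ _ _ us _ (iter_partial_coef (n j) alj gE)) //; last first.
  move=> i is_; rewrite /incrn al0 ?inE ?is_ ?orbT //.
  by case: eqP => // ij; rewrite -ij is_ in js.
rewrite big_cons natrM mulrA; congr (_ * a w _).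
apply/funext => i; rewrite /incrn inE -addnA; congr (_ + _)%N.
case: eqP => [->|_] /=; first by rewrite (negbTE js) addn0.
by [].
Qed.

Lemma taylor_coef0 w : unit_ball w -> a w (fun=> 0%N) = phi w.
Proof.
move=> w1; have [M [s [M0 s0 /(_ 0)]]] := tay w1 0%N.
rewrite rnorm_row0 (ltW s0) addr0 expr0n mulr0 normr_le0 subr_eq0 => /(_ isT) /eqP ->.
rewrite /tpoly (bigD1 [ffun=> ord0]) /=; last first.
  by rewrite /mdeg big1 // => i _; rewrite ffunE.
rewrite [X in _ = _ + X]big1 ?addr0; last first.
  move=> k /andP[_ /eqP k0]; case: k0; apply/ffunP => i; rewrite ffunE.
  exact: ord1.
have -> : (fun i : 'I_d => [ffun=> ord0 : 'I_1] i : nat) = (fun=> 0%N).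
  by apply/funext => i; rewrite ffunE.
by rewrite /monomial big1 ?mulr1 // => i _; rewrite expr0.
Qed.

Lemma mixed_partial_coef (n : 'I_d -> nat) w : unit_ball w ->
  mixed_partial n phi w = (\prod_i (n i)`!)%:R * a w n.
Proof.
move=> w1; rewrite /mixed_partial.
rewrite (foldl_partial_coef n (k := 1) (al := fun=> 0%N)) ?enum_uniq //; last first.
  by move=> v v1; rewrite mul1r taylor_coef0.
rewrite mul1r big_enum; congr (_ * a w _).
by apply/funext => i; rewrite mem_enum mul1n.
Qed.

End MixedPartial.

(** * Taylor estimates from convergent power series *)

Section PowerSeries.
Variables (C : numClosedFieldType) (d : nat).
Local Open Scope classical_set_scope.

Lemma ler_norm_monomial (h : 'rV[C]_d) (rho : C) al : (forall i, `|h 0 i| <= rho) ->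
  `|monomial h al| <= rho ^+ mdeg al.
Proof.
move=> hr; rewrite /monomial normr_prod /mdeg -prodrXr.
apply: ler_prod => i _; rewrite normr_ge0 /= normrX lerXn2r ?nnegrE //.
exact: le_trans (hr i).
Qed.

Lemma tpoly_box N L (c : ('I_d -> nat) -> C) h : (N < L)%N ->
  tpoly N c h = \sum_(k : {ffun 'I_d -> 'I_L} | (mdeg (fun i => k i) <= N)%N)
    c (fun i => k i) * monomial h (fun i => k i).
Proof.
case: L => // L NL.
pose up (k : {ffun 'I_d -> 'I_N.+1}) : {ffun 'I_d -> 'I_L.+1} :=
  [ffun i => widen_ord NL (k i)].
pose down (k : {ffun 'I_d -> 'I_L.+1}) : {ffun 'I_d -> 'I_N.+1} :=
  [ffun i => inord (k i)].
have upE k : (fun i => up k i : nat) = (fun i => k i : nat).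
  by apply/funext => i; rewrite ffunE.
rewrite (reindex_onto up down) /=.
  rewrite /tpoly; apply: eq_big => k; last by rewrite upE.
  rewrite upE; case: (_ <= _)%N => //=; symmetry; apply/eqP/ffunP => i.
  by rewrite !ffunE; apply/val_inj; rewrite /= inordK.
move=> k kN; apply/ffunP => i; apply/val_inj; rewrite !ffunE /= inordK //.
by rewrite ltnS (leq_trans _ kN) // /mdeg (bigD1 i) //= leq_addr.
Qed.

(** Absolute convergence at [y = (s, ..., s)] bounds the sums of [|c_k| s^|k|] by [M]. For
    [|h| <= s] the terms of degree above [N] therefore add up to at most [M (|h| / s)^(N+1)]. *)
Lemma analytic_taylor (f : 'rV[C]_d -> C) (a : 'rV[C]_d) :
  analytic_at f a -> exists c, taylor_at f a c.
Proof.
move=> [c [r [r0 ser]]]; exists c => N.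
(* Dividing [r] by this [D] makes both [s] and the norm of [(s, ..., s)] smaller than [r]. *)
pose D := rnorm (const_mx 1 : 'rV[C]_d) + 2.
have D2 : 2 <= D by rewrite lerDr rnorm_ge0.
have D0 : 0 < D by rewrite (lt_le_trans _ D2).
pose s := r / D; have s0 : 0 < s by rewrite divr_gt0.
have sr : s < r by rewrite ltr_pdivrMr // ltr_pMr // (lt_le_trans _ D2) // ltr1n.
pose y : 'rV[C]_d := const_mx s.
have yr : enorm (a + y - a) < r.
  rewrite addrAC subrr add0r enormE.
  have -> : rnorm y = s * rnorm (const_mx 1 : 'rV[C]_d).
    rewrite -[X in _ = X * _](gtr0_norm s0) /rnorm -l2Z.
    by congr l2; apply/funext => i; rewrite !mxE mulr1.
  by rewrite /s mulrAC ltr_pdivrMr // ltr_pM2l // ltrDl.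
have [[M MB] _] := ser _ yr.
have M0 : 0 <= M by rewrite (le_trans _ (MB 0%N)) // sumr_ge0.
exists (M / s ^+ N.+1), s; split=> //; first by rewrite divr_ge0 // exprn_ge0 // ltW.
move=> h hs; pose rho := rnorm h.
have hr : enorm (a + h - a) < r.
  by rewrite addrAC subrr add0r enormE (le_lt_trans hs).
have [_ lim] := ser _ hr.
apply: (@le_of_small _ _ _ 1 1) => // e e0 _; rewrite mul1r.
move/cvgrPdist_le: lim => /(_ e e0) [L0 _ HL].
(* A box of side [L > N] contains every multi-index of degree at most [N], so [tpoly N c h] is a
   subsum of the partial sum. *)
pose L := maxn L0 N.+1.
have := HL L (leq_maxl _ _); rewrite /= addrAC subrr add0r.
set B := \sum_(k : _) _ => fB.
rewrite -[f _](subrK B) -addrA (le_trans (ler_normD _ _)) // [leRHS]addrC lerD //.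
have NL : (N < L)%N by exact: leq_maxr.
rewrite (tpoly_box _ _ NL) /B.
rewrite (bigID (fun k : {ffun 'I_d -> 'I_L} => (mdeg (fun i => k i) <= N)%N)) /=.
rewrite addrAC subrr add0r; apply: le_trans (ler_norm_sum _ _ _) _.
have := MB L; rewrite addrAC subrr add0r => MBL.
rewrite mulrAC; apply: (le_trans _ (ler_wpM2r _ (ler_wpM2r _ MBL))); last 2 first.
- by rewrite invr_ge0 exprn_ge0 // ltW.
- by rewrite exprn_ge0 // rnorm_ge0.
rewrite -mulrA mulr_suml big_mkcond; apply: ler_sum => k _.
case: ifP => [|_]; last by rewrite mulr_ge0 // divr_ge0 ?exprn_ge0 ?rnorm_ge0 // ltW.
rewrite -ltnNge => Nk; rewrite !normrM -mulrA ler_wpM2l //.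
apply: le_trans (ler_norm_monomial _ (fun i => ler_norm_l2 _ i)) _.
rewrite -/(rnorm h) -/rho.
have -> : `|monomial y (fun i => k i)| = s ^+ mdeg (fun i => k i).
  rewrite /monomial normr_prod /mdeg -prodrXr; apply: eq_bigr => i _.
  by rewrite normrX mxE gtr0_norm.
move: Nk; set m := mdeg _ => /subnKC <-.
have sN0 : s ^+ N.+1 != 0 by rewrite expf_neq0 // gt_eqF.
rewrite !exprD (mulrC (rho ^+ N.+1) (_^-1)) (mulrC (s ^+ N.+1)) -mulrA mulVKf //.
by rewrite mulrC ler_wpM2r ?exprn_ge0 ?rnorm_ge0 // lerXn2r ?nnegrE ?rnorm_ge0 // ltW.
Qed.

End PowerSeries.

Lemma schur_agler_mixed_partial (C : numClosedFieldType) d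
    (phi : 'rV[C]_d -> C) (z : 'rV[C]_d) (n : 'I_d -> nat) :
  schur_agler phi -> unit_ball z -> (0 < mdeg n)%N ->
  `|mixed_partial n phi z| <=
    sqrtC d%:R ^+ (mdeg n - 1) * (\prod_(i < d) (n i)`!)%:R *
    ((1 - `|phi z| ^+ 2) /
     ((1 - enorm z ^+ 2) * (1 - enorm z) ^+ (mdeg n - 1))).
Proof.
move=> sa z1 n0; have pos := schur_agler_positive sa.
(* One coefficient family is chosen for every centre at once; outside the ball it takes the dummy
   value 0. *)
have /choice[a tay] (w : 'rV[C]_d) :
    exists c, unit_ball w -> taylor_at phi w c.
  have [w1|w1] := pselect (unit_ball w); last by exists (fun=> 0).
  by have [c ?] := analytic_taylor (sa.1 w w1); exists c.
rewrite (mixed_partial_coef pos tay n z1) normrM ger0_norm //.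
rewrite mulrAC [leRHS]mulrC ler_wpM2l // enormE.
exact: taylor_coef_bound pos (tay z z1) z1 n0.
Qed.

Theorem theorem12 (R : realType) (d : nat) (hd : (1 <= d)%N)
    (phi : 'rV[complex R]_d -> complex R) (hphi : schur_agler phi)
    (z : 'rV[complex R]_d) (hz : unit_ball z)
    (n : 'I_d -> nat) (hn : exists i, n i <> 0%N) :
  let N := (\sum_(i < d) n i)%N in
  `|mixed_partial n phi z| <=
    sqrtC d%:R ^+ (N - 1) * (\prod_(i < d) (n i)`!)%:R *
    ((1 - `|phi z| ^+ 2) / ((1 - enorm z ^+ 2) * (1 - enorm z) ^+ (N - 1))).
Proof.
apply: schur_agler_mixed_partial => //.
have [i /eqP ni] := hn.
by rewrite /mdeg (bigD1 i) //= addn_gt0 lt0n ni.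
Qed.
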